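(* Let $\Phi$ be a $\operatorname{Spin}(7)$-structure on a smooth $8$-manifold $M$ with torsion tensor $T_{m;\alpha\beta}$. Then the associated metric $g$ has Ricci curvature $R_{jk}$ given by $$R_{jk} = 4\, g^{il} \nabla_{i} T_{j;lk} - 4\, \nabla_{j}\left(g^{il} T_{i;lk}\right) + 8\, T_{j;mk} T_{i;nl} g^{mn} g^{il} - 8\, T_{j;ml} T_{i;nk} g^{mn} g^{il}.$$
   Context: A $\operatorname{Spin}(7)$-structure on a smooth $8$-manifold $M$ (not necessarily compact) is a smooth $4$-form $\Phi$ such that at each point there is a basis $e^1,\dots,e^8$ of the cotangent space in which $\Phi = -\big(e^{1234}+e^{1256}+e^{1278}+e^{3456}+e^{3478}+e^{5678}+e^{1357}-e^{1368}-e^{1458}-e^{1467}-e^{2358}-e^{2367}-e^{2457}+e^{2468}\big)$, where $e^{ijkl}=e^i\wedge e^j\wedge e^k\wedge e^l$. It determines a Riemannian metric $g=g_\Phi$ and an orientation, for which such a basis is oriented orthonormal; then $\ast\Phi=\Phi$. In local coordinates $\Phi=\frac1{24}\Phi_{ijkl}dx^i\wedge dx^j\wedge dx^k\wedge dx^l$, repeated indices are summed, and the sign convention is such that $\Phi_{ijkl}\Phi_{abcd}g^{kc}g^{ld}=6g_{ia}g_{jb}-6g_{ib}g_{ja}-4\Phi_{ijab}$. $\nabla$ is the Levi-Civita connection of $g$. $\Omega^2_7=\{\beta\in\Omega^2: \ast(\Phi\wedge\beta)=-3\beta\}$, equivalently $\beta_{ab}g^{ap}g^{bq}\Phi_{pqij}=-6\beta_{ij}$.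 Torsion tensor: it is known that for each $m$ there is a unique $T_{m;ab}$, lying in $\Omega^2_7$ as a skew tensor in $a,b$, with $\nabla_m\Phi_{ijkl}=T_{m;ip}g^{pq}\Phi_{qjkl}+T_{m;jp}g^{pq}\Phi_{iqkl}+T_{m;kp}g^{pq}\Phi_{ijql}+T_{m;lp}g^{pq}\Phi_{ijkq}$; the tensor $T$ is the torsion tensor of $\Phi$. The Ricci tensor is the usual one (positive on round spheres): $R_{jk}=R_{ijkl}g^{il}$ with $R_{ijkl}=g\big((\nabla_i\nabla_j-\nabla_j\nabla_i)\partial_k,\partial_l\big)$. *)

(* Defs.v *)
From HB Require Import structures.
From mathcomp Require Import all_boot all_order all_algebra.
From mathcomp Require Import all_classical all_reals all_analysis.
Import Order.TTheory GRing.Theory Num.Theory numFieldNormedType.Exports.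

Set Implicit Arguments.
Unset Strict Implicit.
Unset Printing Implicit Defensive.

Local Open Scope classical_set_scope.
Local Open Scope ring_scope.

Definition partial (R : realType) (i : 'I_8) (f : 'rV[R]_8 -> R) :
  'rV[R]_8 -> R := fun x => 'D_(delta_mx 0 i) f x.

Fixpoint iter_partial (R : realType) (s : seq 'I_8) (f : 'rV[R]_8 -> R) :
  'rV[R]_8 -> R :=
  if s is i :: s' then partial i (iter_partial s' f) else f.

(* C^oo on the open set U: the iterated partial derivatives of all orders
   exist and are continuous at every point of U. *)
Definition smooth_on (R : realType) (U : set 'rV[R]_8) (f : 'rV[R]_8 -> R) :=
  forall (s : seq 'I_8) (x : 'rV[R]_8), U x ->
    {for x, continuous (iter_partial s f)} /\
    (forall i : 'I_8, derivable (iter_partial s f) x (delta_mx 0 i)).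

(* chart_map is relevant only on chart_dom, and chart_inv only on chart_img;
   their values elsewhere are junk. *)
Record chart (R : realType) (M : topologicalType) := Chart {
  chart_dom : set M;
  chart_map : M -> 'rV[R]_8;
  chart_inv : 'rV[R]_8 -> M;
  chart_dom_open : open chart_dom;
  chart_img_open : open (chart_map @` chart_dom);
  chart_mapK : forall p, chart_dom p -> chart_inv (chart_map p) = p;
  chart_map_continuous : {within chart_dom, continuous chart_map};
  chart_inv_continuous :
    {within chart_map @` chart_dom, continuous chart_inv} }.

Definition chart_img (R : realType) (M : topologicalType) (a : chart R M) :
  set 'rV[R]_8 := chart_map a @` chart_dom a.

Definition transition (R : realType) (M : topologicalType) (a b : chart R M)
  (k : 'I_8) : 'rV[R]_8 -> R := fun x => chart_map b (chart_inv a x) 0 k.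

Definition overlap (R : realType) (M : topologicalType) (a b : chart R M) :
  set 'rV[R]_8 := chart_map a @` (chart_dom a `&` chart_dom b).

(* The atlas need not be maximal; the maximal one is allowed. *)
Record manifold8 (R : realType) := Manifold8 {
  mpoint :> topologicalType;
  _ : hausdorff_space mpoint;
  _ : @second_countable mpoint;
  atlas : Type;
  chart_of : atlas -> chart R mpoint;
  _ : forall p : mpoint, exists a : atlas, chart_dom (chart_of a) p;
  _ : forall (a b : atlas) (k : 'I_8),
        smooth_on (overlap (chart_of a) (chart_of b))
                  (transition (chart_of a) (chart_of b) k) }.

Section Tensors.
Variables (R : realType) (M : manifold8 R).

Definition img (a : atlas M) : set 'rV[R]_8 := chart_img (chart_of a).

(* jac a b x i k is dy^k/dx^i, x and y being the coordinates of a and b *)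
Definition jac (a b : atlas M) (x : 'rV[R]_8) (i k : 'I_8) : R :=
  partial i (transition (chart_of a) (chart_of b) k) x.

Definition local_tensor (k : nat) := 'rV[R]_8 -> k.-tuple 'I_8 -> R.

(* Smooth covariant k-tensors, given by their components in each chart as
   functions of the coordinates of that chart. *)
Record tensor_field (k : nat) := TensorField {
  components :> atlas M -> local_tensor k;
  components_smooth : forall (a : atlas M) (I : k.-tuple 'I_8),
    smooth_on (img a) (fun x => components a x I);
  components_change : forall (a b : atlas M) (p : M),
    chart_dom (chart_of a) p -> chart_dom (chart_of b) p ->
    forall I : k.-tuple 'I_8,
    let x := chart_map (chart_of a) p in
    let y := chart_map (chart_of b) p in
    components a x I =
      \sum_(J : k.-tuple 'I_8)
         (\prod_(r < k) jac a b x (tnth I r) (tnth J r)) * components b y J }.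

(* Affine connections: D a x p i j is the coefficient Gamma^p_{ij} in
   nabla_i d_j = Gamma^p_{ij} d_p. *)
Record connection := Connection {
  gamma :> atlas M -> 'rV[R]_8 -> 'I_8 -> 'I_8 -> 'I_8 -> R;
  gamma_smooth : forall (a : atlas M) (p i j : 'I_8),
    smooth_on (img a) (fun x => gamma a x p i j);
  gamma_change : forall (a b : atlas M) (q : M),
    chart_dom (chart_of a) q -> chart_dom (chart_of b) q ->
    let x := chart_map (chart_of a) q in
    let y := chart_map (chart_of b) q in
    forall i j k : 'I_8,
    \sum_(p < 8) gamma a x p i j * jac a b x p k =
      partial i (fun z => jac a b z j k) x
      + \sum_(r < 8) \sum_(s < 8)
          jac a b x i r * jac a b x j s * gamma b y k r s }.

(* (nabla t)_{m I}, the index m of the derivative coming first *)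
Definition nabla (D : connection) (a : atlas M) (k : nat) (t : local_tensor k) :
  local_tensor k.+1 :=
  fun x mI =>
    let m := thead mI in
    let I : k.-tuple 'I_8 := [tuple of behead mI] in
    partial m (fun y => t y I) x
    - \sum_(r < k) \sum_(p < 8) D a x p m (tnth I r)
        * t x [tuple (if s == r then p else tnth I s) | s < k].

(* q-th component of nabla_i X for a vector field X = X^p d_p *)
Definition nabla_vec (D : connection) (a : atlas M) (i : 'I_8)
  (X : 'rV[R]_8 -> 'I_8 -> R) : 'rV[R]_8 -> 'I_8 -> R :=
  fun x q => partial i (fun y => X y q) x + \sum_(p < 8) D a x q i p * X x p.

Definition coord_vec (k : 'I_8) : 'rV[R]_8 -> 'I_8 -> R :=
  fun _ q => (q == k)%:R.

Section Metric.
Variable g : tensor_field 2.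

Definition gmx (a : atlas M) (x : 'rV[R]_8) : 'M[R]_8 :=
  \matrix_(i, j) g a x [tuple i; j].

Definition ginv (a : atlas M) (x : 'rV[R]_8) : 'M[R]_8 := invmx (gmx a x).

Definition riemannian_metric : Prop :=
  forall (a : atlas M) (x : 'rV[R]_8), img a x ->
    (gmx a x)^T = gmx a x /\
    (forall v : 'rV[R]_8, v != 0 -> 0 < (v *m gmx a x *m v^T) 0 0).

Definition levi_civita (D : connection) : Prop :=
  forall (a : atlas M) (x : 'rV[R]_8), img a x ->
    (forall p i j : 'I_8, D a x p i j = D a x p j i) /\
    (forall m i j : 'I_8, nabla D a (g a) x [tuple m; i; j] = 0).

(* R_{ijkl} = g ((nabla_i nabla_j - nabla_j nabla_i) d_k, d_l) *)
Definition riem (D : connection) (a : atlas M) (x : 'rV[R]_8)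
  (i j k l : 'I_8) : R :=
  \sum_(q < 8)
     (nabla_vec D a i (nabla_vec D a j (coord_vec k)) x q
      - nabla_vec D a j (nabla_vec D a i (coord_vec k)) x q)
     * gmx a x q l.

Definition ricci (D : connection) (a : atlas M) (x : 'rV[R]_8)
  (j k : 'I_8) : R :=
  \sum_(i < 8) \sum_(l < 8) riem D a x i j k l * ginv a x i l.

End Metric.

(* A coframe e^1, ..., e^8 at a point is the invertible matrix e whose row
   i - 1 holds the components of e^i; wedge4 e i j k l I, with i, ..., l
   numbered from 1, is the component of e^i /\ e^j /\ e^k /\ e^l at I in the
   normalisation omega = 1/4! omega_{abcd} dx^a /\ dx^b /\ dx^c /\ dx^d. *)
Definition wedge4 (e : 'M[R]_8) (i j k l : nat) (I : 4.-tuple 'I_8) : R :=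
  let K : 4.-tuple 'I_8 :=
    [tuple inord i.-1; inord j.-1; inord k.-1; inord l.-1] in
  \det (\matrix_(r < 4, s < 4) e (tnth K r) (tnth I s)).

Definition spin7_model (e : 'M[R]_8) (I : 4.-tuple 'I_8) : R :=
  - (wedge4 e 1 2 3 4 I + wedge4 e 1 2 5 6 I + wedge4 e 1 2 7 8 I
     + wedge4 e 3 4 5 6 I + wedge4 e 3 4 7 8 I + wedge4 e 5 6 7 8 I
     + wedge4 e 1 3 5 7 I - wedge4 e 1 3 6 8 I - wedge4 e 1 4 5 8 I
     - wedge4 e 1 4 6 7 I - wedge4 e 2 3 5 8 I - wedge4 e 2 3 6 7 I
     - wedge4 e 2 4 5 7 I + wedge4 e 2 4 6 8 I).

Definition adapted_coframe (Phi : tensor_field 4) (a : atlas M)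
  (x : 'rV[R]_8) (e : 'M[R]_8) : Prop :=
  e \in unitmx /\ (forall I : 4.-tuple 'I_8, Phi a x I = spin7_model e I).

(* The components of spin7_model e are alternating, so Phi is a 4-form. *)
Definition spin7_structure (Phi : tensor_field 4) : Prop :=
  forall (a : atlas M) (x : 'rV[R]_8), img a x ->
    exists e : 'M[R]_8, adapted_coframe Phi a x e.

Definition orthonormal_coframe (g : tensor_field 2) (a : atlas M)
  (x : 'rV[R]_8) (e : 'M[R]_8) : Prop :=
  e *m ginv g a x *m e^T = 1%:M.

Definition spin7_metric (Phi : tensor_field 4) (g : tensor_field 2) : Prop :=
  riemannian_metric g /\
  (forall (a : atlas M) (x : 'rV[R]_8) (e : 'M[R]_8), img a x ->
    adapted_coframe Phi a x e -> orthonormal_coframe g a x e).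

(* The eigenvalue equation beta_{cd} g^{cp} g^{dq} Phi_{pqij} = - 6 beta_{ij}
   is the index form of *(Phi /\ beta) = - 3 beta. *)
Definition in_Omega2_7 (Phi : tensor_field 4) (g : tensor_field 2)
  (a : atlas M) (x : 'rV[R]_8) (beta : 'I_8 -> 'I_8 -> R) : Prop :=
  (forall i j : 'I_8, beta i j = - beta j i) /\
  (forall i j : 'I_8,
    \sum_(c < 8) \sum_(d < 8) \sum_(p < 8) \sum_(q < 8)
       beta c d * ginv g a x c p * ginv g a x d q * Phi a x [tuple p; q; i; j]
    = - 6 * beta i j).

(* T a x [tuple m; i; j] is T_{m;ij} *)
Definition torsion_tensor (Phi : tensor_field 4) (g : tensor_field 2)
  (D : connection) (T : tensor_field 3) : Prop :=
  forall (a : atlas M) (x : 'rV[R]_8), img a x -> forall m : 'I_8,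
    in_Omega2_7 Phi g a x (fun i j => T a x [tuple m; i; j]) /\
    (forall i j k l : 'I_8,
      nabla D a (Phi a) x [tuple m; i; j; k; l] =
        \sum_(p < 8) \sum_(q < 8)
          (T a x [tuple m; i; p] * ginv g a x p q * Phi a x [tuple q; j; k; l]
         + T a x [tuple m; j; p] * ginv g a x p q * Phi a x [tuple i; q; k; l]
         + T a x [tuple m; k; p] * ginv g a x p q * Phi a x [tuple i; j; q; l]
         + T a x [tuple m; l; p] * ginv g a x p q
             * Phi a x [tuple i; j; k; q])).

Definition torsion_trace (g : tensor_field 2) (T : tensor_field 3)
  (a : atlas M) : local_tensor 1 :=
  fun x K => \sum_(i < 8) \sum_(l < 8)
    ginv g a x i l * T a x [tuple i; l; thead K].

End Tensors.

Arguments nabla {R M} D a {k} t x mI.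

(* Main.v *)
(* Let Y_m = Gamma_m + T_m g^{-1}, acting on every slot of a tensor. The torsion
   equation says that d_m Phi = Y_m . Phi, and d_m g = Y_m . g since T_m is
   skew, so the curvature F_ij = d_i Y_j - d_j Y_i - [Y_i, Y_j] annihilates Phi
   and g: lowered with g it lies in Lambda^2_21. Expanding, F_ij is the Riemann
   tensor plus nabla_i T_j - nabla_j T_i - [T_i, T_j]. Write
   P(A)_kl = A^{pq} Phi_pqkl, which is 2 on Lambda^2_21 and -6 on Lambda^2_7.
   Differentiating P(T_j) = -6 T_j shows that Z_ij = nabla_i T_j - [T_i, T_j]
   lies in Lambda^2_7, and [Lambda^2_7, Lambda^2_7] is in Lambda^2_21; hence
   P(R_ij) = 2 R_ij + 8 (Z_ij - Z_ji). Contracting with g^{il}, the first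
   Bianchi identity kills the left-hand side, and what is left is the formula. *)
Require Import Defs.
From mathcomp Require Import all_boot all_order all_algebra fingroup perm.
From mathcomp Require Import all_classical all_reals all_analysis.
From mathcomp Require Import ring lra.
Import Order.TTheory GRing.Theory Num.Theory numFieldNormedType.Exports.

Set Implicit Arguments.
Unset Strict Implicit.
Unset Printing Implicit Defensive.

Local Open Scope classical_set_scope.
Local Open Scope ring_scope.

(** * Symmetry of mixed partial derivatives *)

Section MixedDerivatives.
Variables (R : realType) (V : normedModType R).
Implicit Types (f : V -> R) (u v w x y : V).

(** Both g and Phi are parallel for the connection [Y], and Z_ij is simply T_j differentiated with
    [Y] instead of Gamma: that substitution produces the commutator. As P is built from g and Phi,
    it commutes with this derivative, so Z_ij inherits the eigenvalue -6 of T_j. Adapted coframes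
    are given only point by point, not as smooth frames. Hence all differentiation is done in
    coordinates on matrices of components, and a coframe serves only for algebra at one point, where
    it reduces a claim to the constant model form. There the claims rest on integer identities
    indexed by four indices below 8, decided by evaluation. The eigenvalue 2 is obtained without
    splitting the 2-forms: contracting A . Phi = 0 with Phi gives 24 A = 12 P(A). For the brackets
    of Lambda^2_7, bilinearity leaves finitely many pairs of generators; the inclusion reflects the
    symmetric pair (so(8), spin(7)). The constant 8 in P(R_ij) is 2 - (-6). *)

Lemma derive_shift f v w x :
  'D_v (fun z => f (z + w)) x = 'D_v f (x + w).
Proof.
rewrite /derive; congr (lim (_ @ 0^')).
by apply/funext => h /=; rewrite addrA.
Qed.

Lemma derivable_shift f v w x :
  derivable f (x + w) v -> derivable (fun z => f (z + w)) x v.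
Proof.
rewrite /derivable; set F := (X in cvg (X @ 0^') -> _).
suff -> : F = (fun h => h^-1 *: (((fun z => f (z + w)) \o shift x) (h *: v)
   - f (x + w))) by [].
by apply/funext => h /=; rewrite /F /= addrA.
Qed.

Lemma is_derive_line f y v (t : R) : derivable f (t *: v + y) v ->
  is_derive t 1 (fun r => f (r *: v + y)) ('D_v f (t *: v + y)).
Proof.
move=> df.
have E : (fun h => h^-1 *: ((f \o shift (t *: v + y)) (h *: v) - f (t *: v + y)))
  = (fun h => h^-1 *: (((fun r => f (r *: v + y)) \o shift t) (h *: 1)
       - f (t *: v + y))).
  by apply/funext => h /=; rewrite addrA -scalerDl [h *: 1]mulr1.
split; first by move: df; rewrite /derivable E.
by rewrite /derive E.
Qed.

Lemma mean_value_line f y v (s : R) : 0 < s ->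
  (forall t : R, 0 <= t <= s -> derivable f (t *: v + y) v) ->
  exists2 t : R, 0 < t < s & f (s *: v + y) - f y = s * 'D_v f (t *: v + y).
Proof.
move=> s0 df; set F := fun r => f (r *: v + y).
have [t|t|t ts] := @MVT R F (fun t => 'D_v f (t *: v + y)) 0 s s0.
- by rewrite in_itv /= => /andP[t0 ts]; apply/is_derive_line/df; rewrite !ltW.
- apply/continuous_in_subspaceT: t => t; rewrite inE /= in_itv /= => /df.
  move=> /is_derive_line[+ _] => /derivable1_diffP.
  exact: differentiable_continuous.
- by rewrite /F scale0r add0r subr0 mulrC; exists t; rewrite // -in_itv.
Qed.

(** The mean value theorem is used twice: along [u] for the increment f(z + s v) - f(z), then along
    [v] for the derivative of [f] in direction [u]. The double difference is symmetric in [u] and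
    [v], which makes the two mixed derivatives comparable. *)
Lemma double_difference f (u v x : V) (s : R) : 0 < s ->
  (forall a b : R, 0 <= a <= s -> 0 <= b <= s ->
     derivable f (a *: u + (b *: v + x)) u
     /\ derivable ('D_u f) (a *: u + (b *: v + x)) v) ->
  exists a b : R, [/\ 0 <= a <= s, 0 <= b <= s &
    f (s *: u + s *: v + x) - f (s *: u + x) - f (s *: v + x) + f x
    = s ^+ 2 * 'D_v ('D_u f) (a *: u + (b *: v + x))].
Proof.
move=> s0 df; pose h z := f (z + s *: v) - f z.
have s00 : 0 <= (0 : R) <= s by rewrite lexx ltW.
have sss : 0 <= s <= s by rewrite lexx ltW.
have dh (a : R) : 0 <= a <= s ->
    derivable (fun z => f (z + s *: v)) (a *: u + x) u
    /\ derivable f (a *: u + x) u.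
  move=> /df dfa; split; last by have [] := dfa 0 s00; rewrite scale0r add0r.
  apply: derivable_shift; rewrite -addrA [x + s *: v]addrC.
  exact: (dfa s sss).1.
have [|a /andP[a0 als]] := @mean_value_line h x u s s0.
  by move=> t /dh[d1 d2]; apply: (@derivableB _ _ _ _ f); [exact: d1|exact: d2].
have as' : 0 <= a <= s by rewrite !ltW.
have -> : 'D_u h (a *: u + x) = 'D_u f (s *: v + (a *: u + x))
                                - 'D_u f (a *: u + x).
  have [d1 d2] := dh a as'.
  rewrite [LHS](@deriveB _ _ _ (fun z => f (z + s *: v)) f)// derive_shift.
  by rewrite [s *: v + _]addrC.
have [|b /andP[b0 bs] ->] := @mean_value_line ('D_u f) (a *: u + x) v s s0.
  by move=> t /(df a t as')[_]; rewrite addrCA.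
rewrite mulrA -expr2 addrCA => hE; exists a, b; split => //; first by rewrite !ltW.
by rewrite -hE /h [x + _]addrC [s *: u + x + _]addrAC; ring.
Qed.

(** Schwarz's theorem: the double difference over a small parallelogram is s^2 times either mixed
    derivative, each taken at its own point, and continuity at [x] brings both points back to
    [x]. *)
Lemma derive_comm f (u v x : V) :
  (\forall y \near x, [/\ derivable f y u, derivable f y v,
     derivable ('D_u f) y v & derivable ('D_v f) y u]) ->
  {for x, continuous ('D_v ('D_u f))} -> {for x, continuous ('D_u ('D_v f))} ->
  'D_v ('D_u f) x = 'D_u ('D_v f) x.
Proof.
move=> df c1 c2; apply/eqP; rewrite -subr_eq0 -normr_le0; apply/ler_addgt0Pl.
move=> e e0; rewrite addr0.
have e20 : 0 < e / 2 by rewrite divr_gt0.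
have /nbhs_ballP[d /= d0 dP] : \forall y \near x,
     [/\ derivable f y u, derivable f y v, derivable ('D_u f) y v & derivable ('D_v f) y u] /\
     (`|'D_v ('D_u f) x - 'D_v ('D_u f) y| < e / 2
     /\ `|'D_u ('D_v f) x - 'D_u ('D_v f) y| < e / 2).
  apply: filterS2 df _ => [y + h|]; first by split; [|exact: h].
  apply: filterI; [move/cvgrPdist_lt: c1 => /(_ _ e20)//|].
  by move/cvgrPdist_lt: c2 => /(_ _ e20).
(* With this side the parallelogram stays in the ball of radius [d]; the summand 1 keeps the
   denominator positive when [u] and [v] vanish. *)
pose s := d / (`|u| + `|v| + 1).
have n0 : 0 < `|u| + `|v| + 1 by rewrite ltr_wpDl ?addr_ge0.
have s0 : 0 < s by rewrite divr_gt0.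
have sB (a b : R) : 0 <= a <= s -> 0 <= b <= s -> ball x d (a *: u + (b *: v + x)).
  move=> /andP[a0 als] /andP[b0 bs]; rewrite -ball_normE /=.
  rewrite addrA opprD addrCA subrr addr0 normrN.
  apply: (le_lt_trans (ler_normD _ _)); rewrite !normrZ !ger0_norm//.
  have : `|u| + `|v| < `|u| + `|v| + 1 by rewrite ltrDl.
  rewrite -(ltr_pM2l s0) {2}/s divfK ?gt_eqF//.
  apply: le_lt_trans; rewrite mulrDr lerD// ler_wpM2r//.
have [a|a [b [as' bs E1]]] := @double_difference f u v x s s0.
  by move=> b a0 b0; have [[]] := dP _ (sB _ _ a0 b0).
have [a'|a' [b' [a's b's E2]]] := @double_difference f v u x s s0.
  move=> b' a0 b0; have [[_ d1 _ d2] _] := dP _ (sB _ _ b0 a0).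
  by rewrite [a' *: v + _]addrCA; split; [exact: d1|exact: d2].
rewrite [a' *: v + _]addrCA in E2.
have E : 'D_u ('D_v f) (b' *: u + (a' *: v + x))
    = 'D_v ('D_u f) (a *: u + (b *: v + x)).
  apply: (@mulfI _ (s ^+ 2)); first by rewrite expf_neq0 ?gt_eqF.
  rewrite [LHS](esym E2) [RHS](esym E1) [s *: v + s *: u]addrC.
  by congr (_ + _); exact: addrAC.
have [_ [_]] := dP _ (sB _ _ b's a's); have [_ [+ _]] := dP _ (sB _ _ as' bs).
rewrite E [leRHS](splitr e); move: ('D_v ('D_u f) x) ('D_u ('D_v f) x) => p q.
move: ('D_v ('D_u f) _) => r h1 h2.
apply/ltW/(le_lt_trans (ler_distD r p q)); rewrite [`|r - q|]distrC.
exact: (ltrD h1 h2).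
Qed.

End MixedDerivatives.

(** * The model 4-form *)

(** Cofactor expansion along the rows in closed integer form, which evaluates on concrete
    indices. *)
Definition det4 (m : nat -> nat -> int) : int :=
  let d2 a b c d := m 2%N a * m 3%N b - m 2%N c * m 3%N d in
  let d3 a b c := m 1%N a * d2 b c c b - m 1%N b * d2 a c c a
                  + m 1%N c * d2 a b b a in
  m 0%N 0%N * d3 1%N 2%N 3%N - m 0%N 1%N * d3 0%N 2%N 3%N
  + m 0%N 2%N * d3 0%N 1%N 3%N - m 0%N 3%N * d3 0%N 1%N 2%N.

Lemma det_nat_row0 (n : nat) (m : nat -> nat -> int) :
  \det (\matrix_(r < n.+1, s < n.+1) m r s) =
  \sum_(c < n.+1) m 0%N c * ((-1) ^+ c
     * \det (\matrix_(r < n, s < n) m r.+1 (bump c s))).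
Proof.
rewrite (expand_det_row _ ord0); apply: eq_bigr => c _.
rewrite mxE /cofactor add0n; congr (_ * (_ * \det _)).
by apply/matrixP => r s; rewrite !mxE.
Qed.

Lemma det4E (m : nat -> nat -> int) :
  \det (\matrix_(r < 4, s < 4) m r s) = det4 m.
Proof.
rewrite det_nat_row0 !big_ord_recl big_ord0 /=.
rewrite !(det_nat_row0 _ (fun r s => m r.+1 (bump _ s))).
rewrite !big_ord_recl !big_ord0 /=.
rewrite !(det_nat_row0 _ (fun r s => m r.+2 (bump _ (bump _ s)))).
rewrite !big_ord_recl !big_ord0 /= !det_mx11 !mxE /bump /=.
rewrite /det4 /=; ring.
Qed.

(* The overall sign of the 4-form is not included; it appears in phi_det. *)
Definition spin7_blocks : seq (int * seq nat) :=
  [:: (1, [:: 1; 2; 3; 4]%N); (1, [:: 1; 2; 5; 6]%N); (1, [:: 1; 2; 7; 8]%N);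
      (1, [:: 3; 4; 5; 6]%N); (1, [:: 3; 4; 7; 8]%N); (1, [:: 5; 6; 7; 8]%N);
      (1, [:: 1; 3; 5; 7]%N); (-1, [:: 1; 3; 6; 8]%N); (-1, [:: 1; 4; 5; 8]%N);
      (-1, [:: 1; 4; 6; 7]%N); (-1, [:: 2; 3; 5; 8]%N); (-1, [:: 2; 3; 6; 7]%N);
      (-1, [:: 2; 4; 5; 7]%N); (1, [:: 2; 4; 6; 8]%N)].

(** A component of a wedge of standard covectors. The entries of [K] count from 1 and the indices p,
    q, r, s from 0, hence the predecessor. *)
Definition block_wedge (K : seq nat) (p q r s : nat) : int :=
  det4 (fun x y => ((nth 0%N K x).-1 == nth 0%N [:: p; q; r; s] y)%:Z).

Definition phi_det (p q r s : nat) : int :=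
  foldr (fun b z => z - b.1 * block_wedge b.2 p q r s) 0 spin7_blocks.

(* Tabulated so that the identities below can be checked by evaluation. *)
Definition phi_table : seq (seq (seq (seq int))) := Eval vm_compute in
  let r8 := iota 0 8 in
  [seq [seq [seq [seq phi_det i j k l | l <- r8] | k <- r8] | j <- r8] | i <- r8].

Definition phi (i j k l : nat) : int :=
  nth 0 (nth [::] (nth [::] (nth [::] phi_table i) j) k) l.

Definition all8 (P : nat -> bool) : bool := all P (iota 0 8).

Lemma all8P (P : nat -> bool) : all8 P -> forall i : 'I_8, P i.
Proof. by move=> /allP h i; apply: h; rewrite mem_iota /=. Qed.

Definition sum8 (f : nat -> int) : int :=
  f 0 + (f 1 + (f 2 + (f 3 + (f 4 + (f 5 + (f 6 + f 7)))))).

Lemma sum8E (R : comPzRingType) (f : nat -> int) :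
  \sum_(i < 8) (f i)%:~R = (sum8 f)%:~R :> R.
Proof. by rewrite !big_ord_recl big_ord0 addr0 /= /bump /= /sum8 !rmorphD. Qed.

(** Packs 4096 integer equalities into one boolean that evaluation decides. *)
Lemma all8P4 (F G : nat -> nat -> nat -> nat -> int) :
  all8 (fun i => all8 (fun j => all8 (fun k => all8 (fun l =>
    F i j k l == G i j k l)))) ->
  forall i j k l : 'I_8, F i j k l = G i j k l.
Proof.
move=> H i j k l; apply/eqP.
by have /all8P/(_ j)/all8P/(_ k)/all8P/(_ l) := all8P H i.
Qed.

Lemma phi_phi_det (i j k l : 'I_8) : phi i j k l = phi_det i j k l.
Proof. by apply: (@all8P4 phi phi_det); vm_compute. Qed.

Lemma phi_swap12 (i j k l : 'I_8) : phi j i k l = - phi i j k l.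
Proof.
by apply: (@all8P4 (fun i j k l => phi j i k l) (fun i j k l => - phi i j k l));
  vm_compute.
Qed.

Lemma phi_swap23 (i j k l : 'I_8) : phi i k j l = - phi i j k l.
Proof.
by apply: (@all8P4 (fun i j k l => phi i k j l) (fun i j k l => - phi i j k l));
  vm_compute.
Qed.

Lemma phi_swap34 (i j k l : 'I_8) : phi i j l k = - phi i j k l.
Proof.
by apply: (@all8P4 (fun i j k l => phi i j l k) (fun i j k l => - phi i j k l));
  vm_compute.
Qed.

Definition kron2 (i j a b : nat) : int :=
  ((i == a) && (j == b))%:Z - ((i == b) && (j == a))%:Z.

(** This is the contraction identity that expresses the sign convention for the 4-form, in the
    standard coframe. *)
Lemma phi_contract (i j a b : 'I_8) :
  sum8 (fun k => sum8 (fun l => phi i j k l * phi a b k l))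
  = 6 * kron2 i j a b - 4 * phi i j a b.
Proof.
apply: (@all8P4
  (fun i j a b => sum8 (fun k => sum8 (fun l => phi i j k l * phi a b k l)))
  (fun i j a b => 6 * kron2 i j a b - 4 * phi i j a b)).
by vm_compute.
Qed.

(* For e = 1, ..., 7 these skew matrices span Lambda^2_7: up to scale gen e is
   the Lambda^2_7-part of e^0 /\ e^e. *)
Definition gen (e a b : nat) : int := kron2 0 e a b - phi 0 e a b.

(** Contracted with a skew matrix U, the left-hand side gives 2 U - P(U), which is 8 on Lambda^2_7
    and 0 on Lambda^2_21. The identity thus resolves 8 times the projection onto Lambda^2_7 into
    generators; the term with e = 0 vanishes. *)
Lemma gen_complete (a b c d : 'I_8) :
  kron2 a b c d - phi a b c d = sum8 (fun e => gen e a b * gen e c d).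
Proof.
apply: (@all8P4 (fun a b c d => kron2 a b c d - phi a b c d)
  (fun a b c d => sum8 (fun e => gen e a b * gen e c d))).
by vm_compute.
Qed.

Definition gen_comm (e f a b : nat) : int :=
  sum8 (fun p => gen e a p * gen f p b) - sum8 (fun p => gen f a p * gen e p b).

(** Brackets of generators of Lambda^2_7 are eigenvectors of P for 2, that is, they lie in
    Lambda^2_21. *)
Lemma phi_gen_comm (e f c d : 'I_8) :
  sum8 (fun a => sum8 (fun b => gen_comm e f a b * phi a b c d))
  = 2 * gen_comm e f c d.
Proof.
(* Each commutator is tabulated once per pair (e, f), so that its entries are not recomputed inside
   every sum. *)
suff H : all8 (fun e => all8 (fun f =>
    let t := mkseq (fun a => mkseq (gen_comm e f a) 8) 8 in
    let m a b := nth 0 (nth [::] t a) b in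
    all8 (fun c => all8 (fun d =>
      sum8 (fun a => sum8 (fun b => m a b * phi a b c d)) == 2 * m c d)))).
  move: H => /all8P/(_ e)/all8P/(_ f)/=/all8P/(_ c)/all8P/(_ d)/eqP.
  by rewrite !nth_mkseq.
by vm_compute.
Qed.

(** * Linear maps acting on tensors *)

Definition subst_at (k : nat) (I : k.-tuple 'I_8) (r : 'I_k) (p : 'I_8) :
  k.-tuple 'I_8 := [tuple (if s == r then p else tnth I s) | s < k].

Section Slots.
Variables (R : realFieldType) (k : nat).
Implicit Types (X Y : 'M[R]_8) (F : k.-tuple 'I_8 -> R) (I : k.-tuple 'I_8).

Lemma tnth_subst I r p s :
  tnth (subst_at I r p) s = if s == r then p else tnth I s.
Proof. by rewrite tnth_mktuple. Qed.

Lemma subst_substC I r s p q : r != s ->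
  subst_at (subst_at I r p) s q = subst_at (subst_at I s q) r p.
Proof.
move=> rs; apply: eq_from_tnth => t; rewrite !tnth_subst.
by case: eqVneq => // ->; rewrite eq_sym (negPf rs).
Qed.

Lemma subst_subst I r p q : subst_at (subst_at I r p) r q = subst_at I r q.
Proof.
by apply: eq_from_tnth => t; rewrite !tnth_subst; case: eqVneq.
Qed.

Definition slot (r : 'I_k) X F : k.-tuple 'I_8 -> R :=
  fun I => \sum_p X (tnth I r) p * F (subst_at I r p).

(** The derivation extension of [X]: the action of the Lie algebra gl(8) on covariant tensors. *)
Definition act X F : k.-tuple 'I_8 -> R := fun I => \sum_r slot r X F I.

Lemma slotM r X Y F : slot r X (slot r Y F) = slot r (X *m Y) F.
Proof.
apply/funext => I; rewrite /slot.
under eq_bigr do rewrite big_distrr /=.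
rewrite exchange_big; apply: eq_bigr => q _.
rewrite mxE big_distrl; apply: eq_bigr => p _.
by rewrite tnth_subst eqxx subst_subst mulrA.
Qed.

Lemma slotC r s X Y F : r != s ->
  slot r X (slot s Y F) = slot s Y (slot r X F).
Proof.
move=> rs; apply/funext => I; rewrite /slot.
under eq_bigr do rewrite big_distrr /=.
under [RHS]eq_bigr do rewrite big_distrr /=.
rewrite exchange_big; apply: eq_bigr => q _; apply: eq_bigr => p _.
rewrite !tnth_subst (negPf rs) eq_sym (negPf rs) subst_substC//.
by rewrite mulrCA.
Qed.

Lemma slot1 r F : slot r 1%:M F = F.
Proof.
apply/funext => I; rewrite /slot (bigD1 (tnth I r))//= big1 ?addr0.
  rewrite mxE eqxx mul1r; congr F.
  by apply: eq_from_tnth => t; rewrite tnth_subst; case: eqVneq => [->|].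
by move=> p; rewrite eq_sym mxE => /negPf ->; rewrite mul0r.
Qed.

Lemma slotDl r X Y F I : slot r (X + Y) F I = slot r X F I + slot r Y F I.
Proof.
by rewrite /slot -big_split; apply: eq_bigr => p _; rewrite mxE mulrDl.
Qed.

Lemma slotNl r X F I : slot r (- X) F I = - slot r X F I.
Proof. by rewrite /slot -sumrN; apply: eq_bigr => p _; rewrite mxE mulNr. Qed.

Lemma slot_sumr (J : Type) (s : seq J) r X (F : J -> k.-tuple 'I_8 -> R) I :
  slot r X (fun I' => \sum_(j <- s) F j I') I = \sum_(j <- s) slot r X (F j) I.
Proof.
by rewrite /slot exchange_big; apply: eq_bigr => p _; rewrite big_distrr.
Qed.

Lemma slot0r r X I : slot r X (fun _ => 0) I = 0.
Proof. by rewrite /slot big1 // => p _; rewrite mulr0. Qed.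

Lemma actDl X Y F I : act (X + Y) F I = act X F I + act Y F I.
Proof. by rewrite /act -big_split; apply: eq_bigr => r _; exact: slotDl. Qed.

Lemma actNl X F I : act (- X) F I = - act X F I.
Proof. by rewrite /act -sumrN; apply: eq_bigr => r _; exact: slotNl. Qed.

(** Maps placed in different slots commute, so only the terms with both maps in the same slot
    survive, and there they compose as matrices. *)
Lemma act_comm X Y F I :
  act X (act Y F) I - act Y (act X F) I = act (X *m Y - Y *m X) F I.
Proof.
have E Z W : act Z (act W F) I = \sum_r \sum_s slot r Z (slot s W F) I.
  by rewrite /act; apply: eq_bigr => r _; rewrite slot_sumr.
rewrite !E [X in _ - X]exchange_big /= -sumrB; apply: eq_bigr => r _.
rewrite -sumrB (bigD1 r)//= big1 ?addr0 => [|s sr].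
  by rewrite !slotM slotDl slotNl.
by rewrite slotC 1?eq_sym// subrr.
Qed.

(** The covector in row a may depend on the column s. This keeps the family stable under a linear
    map put into a single slot, which changes one column only. *)
Definition det_tensor (u : 'I_k -> 'I_k -> 'I_8 -> R) : k.-tuple 'I_8 -> R :=
  fun I => \det (\matrix_(a < k, s < k) u a s (tnth I s)).

Lemma slot_det r X (u : 'I_k -> 'I_k -> 'I_8 -> R) :
  slot r X (det_tensor u) = det_tensor (fun a s i =>
    if s == r then \sum_p X i p * u a s p else u a s i).
Proof.
apply/funext => I; rewrite /slot /det_tensor (expand_det_col _ r).
under eq_bigr do rewrite (expand_det_col _ r) big_distrr /=.
rewrite exchange_big; apply: eq_bigr => a _.
rewrite mxE eqxx big_distrl; apply: eq_bigr => p _.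
rewrite mxE tnth_subst eqxx mulrA; congr (_ * (_ * \det _)).
by apply/matrixP => b s; rewrite !mxE tnth_subst eq_sym (negPf (neq_lift _ _)).
Qed.

End Slots.

(** * Tensors of degree four: change of frame and contraction with a bivector *)

Section Slots4.
Variable R : realFieldType.
Implicit Types (X Y E M : 'M[R]_8) (F : 4.-tuple 'I_8 -> R).

Lemma subst4 (i j k l p : 'I_8) :
  [/\ subst_at [tuple i; j; k; l] (inord 0) p = [tuple p; j; k; l],
      subst_at [tuple i; j; k; l] (inord 1) p = [tuple i; p; k; l],
      subst_at [tuple i; j; k; l] (inord 2) p = [tuple i; j; p; l] &
      subst_at [tuple i; j; k; l] (inord 3) p = [tuple i; j; k; p]].
Proof.
by split; apply: eq_from_tnth => t; rewrite tnth_subst -val_eqE /= inordK//;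
  case: t => -[|[|[|[|//]]]].
Qed.

Definition pull E F := slot (inord 0) E (slot (inord 1) E
  (slot (inord 2) E (slot (inord 3) E F))).

Lemma act4E X F I : act X F I = slot (inord 0) X F I + slot (inord 1) X F I
  + slot (inord 2) X F I + slot (inord 3) X F I.
Proof.
rewrite /act !big_ord_recr big_ord0 /= add0r.
by congr (_ + _ + _ + _); congr (slot _ X F I); apply/val_inj; rewrite /= inordK.
Qed.

Lemma inord4_neq : [/\ inord 1 != inord 0 :> 'I_4,
  inord 2 != inord 0 :> 'I_4, inord 3 != inord 0 :> 'I_4 &
  [/\ inord 2 != inord 1 :> 'I_4, inord 3 != inord 1 :> 'I_4
    & inord 3 != inord 2 :> 'I_4]].
Proof. by split; [..|split]; rewrite -val_eqE /= !inordK. Qed.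

Lemma inord4_cases (r : 'I_4) :
  [\/ r = inord 0, r = inord 1, r = inord 2 | r = inord 3].
Proof.
rewrite -(inord_val r); case: r => -[|[|[|[|//]]]] /= _;
  [exact: Or41 | exact: Or42 | exact: Or43 | exact: Or44].
Qed.

Lemma pull_sumr (J : Type) (s : seq J) E (F : J -> 4.-tuple 'I_8 -> R) :
  pull E (fun I => \sum_(j <- s) F j I) = fun I => \sum_(j <- s) pull E (F j) I.
Proof.
have h (r : 'I_4) (H : J -> 4.-tuple 'I_8 -> R) :
    slot r E (fun I => \sum_(j <- s) H j I)
    = fun I => \sum_(j <- s) slot r E (H j) I.
  by apply/funext => I; exact: slot_sumr.
by rewrite /pull (h (inord 3)) (h (inord 2)) (h (inord 1)) (h (inord 0)).
Qed.

Lemma pullZ c E F : pull E (fun I => c * F I) = fun I => c * pull E F I.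
Proof.
have h (r : 'I_4) H : slot r E (fun I => c * H I) = fun I => c * slot r E H I.
  apply/funext => I; rewrite /slot big_distrr; apply: eq_bigr => p _.
  by rewrite mulrCA.
by rewrite /pull (h (inord 3)) (h (inord 2)) (h (inord 1)) (h (inord 0)).
Qed.

(** [X] is moved past the copies of [E] in other slots, meets the one in its own slot, and comes out
    on the inner side as [X']. *)
Lemma slot_pull r X X' E F : X *m E = E *m X' ->
  slot r X (pull E F) = pull E (slot r X' F).
Proof.
move=> XE; rewrite /pull.
have [n10 n20 n30 [n21 n31 n32]] := inord4_neq.
have := inord4_cases r.
move: (inord 0 : 'I_4) (inord 1 : 'I_4) (inord 2 : 'I_4) (inord 3 : 'I_4)
  n10 n20 n30 n21 n31 n32 => r0 r1 r2 r3 n10 n20 n30 n21 n31 n32 [] ->.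
- rewrite slotM XE -slotM -(slotC _ _ _ n10) -(slotC _ _ _ n20).
  by rewrite -(slotC _ _ _ n30).
- rewrite (slotC _ _ _ n10) slotM XE -slotM -(slotC _ _ _ n21).
  by rewrite -(slotC _ _ _ n31).
- rewrite (slotC _ _ _ n20) (slotC _ _ _ n21) slotM XE -slotM.
  by rewrite -(slotC _ _ _ n32).
- rewrite (slotC _ _ _ n30) (slotC _ _ _ n31) (slotC _ _ _ n32).
  by rewrite slotM XE -slotM.
Qed.

Lemma act_pull X X' E F : X *m E = E *m X' ->
  act X (pull E F) = pull E (act X' F).
Proof.
move=> XE; rewrite [in RHS]/act pull_sumr; apply/funext => I.
by apply: eq_bigr => r _; rewrite (slot_pull _ _ XE).
Qed.

Lemma pullK E E' F : E' *m E = 1%:M -> pull E' (pull E F) = F.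
Proof.
move=> EE; rewrite /pull; have [n10 n20 n30 [n21 n31 n32]] := inord4_neq.
move: (inord 0 : 'I_4) (inord 1 : 'I_4) (inord 2 : 'I_4) (inord 3 : 'I_4)
  n10 n20 n30 n21 n31 n32 => r0 r1 r2 r3 n10 n20 n30 n21 n31 n32.
rewrite (slotC _ _ _ n30) (slotC _ _ _ n31) (slotC _ _ _ n32) slotM EE slot1.
rewrite (slotC _ _ _ n20) (slotC _ _ _ n21) slotM EE slot1.
by rewrite (slotC _ _ _ n10) slotM EE slot1 slotM EE slot1.
Qed.

Lemma pull0 E I : pull E (fun _ => 0) I = 0.
Proof.
have h (r : 'I_4) : slot r E (fun _ => 0) = fun _ => 0.
  by apply/funext => J; exact: slot0r.
by rewrite /pull !h.
Qed.

Definition contract12 M F : 'M[R]_8 :=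
  \matrix_(k, l) \sum_p \sum_q M p q * F [tuple p; q; k; l].

Lemma contract12D M N F : contract12 (M + N) F = contract12 M F + contract12 N F.
Proof.
apply/matrixP => k l; rewrite !mxE -big_split; apply: eq_bigr => p _ /=.
by rewrite -big_split; apply: eq_bigr => q _; rewrite mxE mulrDl.
Qed.

Lemma contract12Z c M F : contract12 (c *: M) F = c *: contract12 M F.
Proof.
apply/matrixP => k l; rewrite !mxE big_distrr; apply: eq_bigr => p _ /=.
by rewrite big_distrr; apply: eq_bigr => q _ /=; rewrite mxE mulrA.
Qed.

Lemma contract12N M F : contract12 (- M) F = - contract12 M F.
Proof. by rewrite -scaleN1r contract12Z scaleN1r. Qed.

Lemma contract12_sum (J : finType) (M : J -> 'M[R]_8) F :
  contract12 (\sum_j M j) F = \sum_j contract12 (M j) F.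
Proof.
have h0 : contract12 0 F = 0.
  apply/matrixP => k l; rewrite !mxE big1 // => p _; rewrite big1 // => q _.
  by rewrite mxE mul0r.
exact: (big_morph _ (fun M N => contract12D M N F) h0).
Qed.

Lemma contract12Dr M F F' : contract12 M (fun I => F I + F' I)
  = contract12 M F + contract12 M F'.
Proof.
apply/matrixP => k l; rewrite !mxE -big_split; apply: eq_bigr => p _ /=.
by rewrite -big_split; apply: eq_bigr => q _; rewrite mulrDr.
Qed.

Lemma contract12_slot M E F :
  [/\ contract12 M (slot (inord 0) E F) = contract12 (E^T *m M) F,
      contract12 M (slot (inord 1) E F) = contract12 (M *m E) F,
      contract12 M (slot (inord 2) E F) = E *m contract12 M F &
      contract12 M (slot (inord 3) E F) = contract12 M F *m E^T].
Proof.
have t4 i j k l : [/\ tnth [tuple i; j; k; l] (inord 0) = i :> 'I_8,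
   tnth [tuple i; j; k; l] (inord 1) = j :> 'I_8,
   tnth [tuple i; j; k; l] (inord 2) = k :> 'I_8 &
   tnth [tuple i; j; k; l] (inord 3) = l :> 'I_8].
  by rewrite !(tnth_nth i) !inordK.
split; apply/matrixP => k l; rewrite !mxE /slot.
- rewrite exchange_big [RHS]exchange_big; apply: eq_bigr => q _ /=.
  under eq_bigr do rewrite big_distrr /=.
  rewrite exchange_big; apply: eq_bigr => a _; rewrite mxE big_distrl /=.
  apply: eq_bigr => p _; have [-> _ _ _] := t4 p q k l.
  by have [-> _ _ _] := subst4 p q k l a; rewrite mxE mulrCA mulrA.
- apply: eq_bigr => p _; under eq_bigr do rewrite big_distrr /=.
  rewrite exchange_big; apply: eq_bigr => a _; rewrite mxE big_distrl /=.
  apply: eq_bigr => q _; have [_ -> _ _] := t4 p q k l.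
  by have [_ -> _ _] := subst4 p q k l a; rewrite mulrA.
- under [RHS]eq_bigr do rewrite mxE big_distrr /=.
  rewrite [RHS]exchange_big; apply: eq_bigr => p _ /=.
  under [RHS]eq_bigr do rewrite big_distrr /=.
  rewrite [RHS]exchange_big; apply: eq_bigr => q _ /=; rewrite big_distrr.
  apply: eq_bigr => a _; have [_ _ -> _] := t4 p q k l.
  by have [_ _ -> _] := subst4 p q k l a; rewrite /=; ring.
- under [RHS]eq_bigr do rewrite mxE big_distrl /=.
  rewrite [RHS]exchange_big; apply: eq_bigr => p _ /=.
  under [RHS]eq_bigr do rewrite big_distrl /=.
  rewrite [RHS]exchange_big; apply: eq_bigr => q _ /=; rewrite big_distrr.
  apply: eq_bigr => a _; have [_ _ _ ->] := t4 p q k l.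
  by have [_ _ _ ->] := subst4 p q k l a; rewrite mxE /=; ring.
Qed.

Lemma contract12_pull M E F : contract12 M (pull E F) =
  E *m contract12 (E^T *m M *m E) F *m E^T.
Proof.
rewrite /pull.
have [-> _ _ _] := contract12_slot M E (slot (inord 1) E
  (slot (inord 2) E (slot (inord 3) E F))).
have [_ -> _ _] := contract12_slot (E^T *m M) E
  (slot (inord 2) E (slot (inord 3) E F)).
have [_ _ -> _] := contract12_slot (E^T *m M *m E) E (slot (inord 3) E F).
by have [_ _ _ ->] := contract12_slot (E^T *m M *m E) E F; rewrite mulmxA.
Qed.

(** The product rule behind the equivariance of P: the two contracted slots pass [Y] to [M], the two
    free slots let it out as a factor. *)
Lemma contract12_act M Y F : contract12 M (act Y F) =
  contract12 (Y^T *m M + M *m Y) F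
  + Y *m contract12 M F + contract12 M F *m Y^T.
Proof.
have -> : act Y F = fun I => slot (inord 0) Y F I + slot (inord 1) Y F I
  + slot (inord 2) Y F I + slot (inord 3) Y F I.
  by apply/funext => J; rewrite act4E.
rewrite !contract12Dr contract12D.
by have [-> -> -> ->] := contract12_slot M Y F.
Qed.

End Slots4.

(** * The 4-form of an arbitrary coframe as a pullback of the standard one *)

Section Model.
Variable R : realType.
Implicit Types (A U V E G : 'M[R]_8) (F : 4.-tuple 'I_8 -> R).

Lemma wedge4_pull (e : 'M[R]_8) a b c d :
  wedge4 e a b c d = pull e^T (wedge4 1%:M a b c d).
Proof.
pose K : 4.-tuple 'I_8 := [tuple inord a.-1; inord b.-1; inord c.-1; inord d.-1].
have -> : wedge4 1%:M a b c d
    = det_tensor (fun r _ i => (1%:M : 'M[R]_8) (tnth K r) i) by [].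
rewrite /pull !slot_det.
have -> : wedge4 e a b c d = det_tensor (fun r _ i => e (tnth K r) i) by [].
congr det_tensor; apply/funext => r; apply/funext => s; apply/funext => i.
have h : \sum_p e^T i p * (1%:M : 'M[R]_8) (tnth K r) p = e (tnth K r) i.
  rewrite (bigD1 (tnth K r))//= big1 ?addr0 => [|p /negPf pK].
    by rewrite !mxE eqxx mulr1.
  by rewrite !mxE eq_sym pK mulr0.
have [n10 n20 n30 [n21 n31 n32]] := inord4_neq.
have := inord4_cases s.
move: (inord 0 : 'I_4) (inord 1 : 'I_4) (inord 2 : 'I_4) (inord 3 : 'I_4)
  n10 n20 n30 n21 n31 n32 => r0 r1 r2 r3 n10 n20 n30 n21 n31 n32.
have sy (x y : 'I_4) : y != x -> ((x == y) = false) * ((y == x) = false).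
  by move=> xy; rewrite eq_sym (negPf xy).
have [[s10 s20] s30] := (sy _ _ n10, sy _ _ n20, sy _ _ n30).
have [[s21 s31] s32] := (sy _ _ n21, sy _ _ n31, sy _ _ n32).
by case=> ->; rewrite !(eqxx, s10, s20, s30, s21, s31, s32) h.
Qed.

Lemma spin7_modelE (e : 'M[R]_8) :
  spin7_model e = fun I => \sum_(b <- spin7_blocks) (- b.1%:~R) *
    let K := nth 0%N b.2 in wedge4 e (K 0%N) (K 1%N) (K 2%N) (K 3%N) I.
Proof.
apply/funext => I.
rewrite /spin7_model /spin7_blocks !big_cons big_nil /= !rmorphN !rmorph1; ring.
Qed.

Lemma spin7_model_pull (e : 'M[R]_8) :
  spin7_model e = pull e^T (spin7_model 1%:M).
Proof.
rewrite !spin7_modelE pull_sumr; apply/funext => I.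
by apply: eq_bigr => b _ /=; rewrite wedge4_pull pullZ.
Qed.

(** Links determinants over [R] to the integer table, so that evaluated identities hold for the
    model form. *)
Lemma spin7_model_phi (i j k l : 'I_8) :
  spin7_model (1%:M : 'M[R]_8) [tuple i; j; k; l] = (phi i j k l)%:~R.
Proof.
have w4 a b c d : all (fun n => n.-1 < 8)%N [:: a; b; c; d] ->
    wedge4 (1%:M : 'M[R]_8) a b c d [tuple i; j; k; l]
    = (block_wedge [:: a; b; c; d] i j k l)%:~R.
  move=> /and5P[a8 b8 c8 d8 _]; rewrite /block_wedge -det4E -det_map_mx.
  congr (\det _); apply/matrixP => r s; rewrite !mxE -val_eqE /=.
  by case: r s => -[|[|[|[|//]]]] /= ? [[|[|[|[|//]]]] /= ?];
    rewrite !(tnth_nth i) /= inordK//; case: eqP.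
have -> : phi i j k l = \sum_(b <- spin7_blocks) - (b.1 * block_wedge b.2 i j k l).
  rewrite phi_phi_det /phi_det; elim: spin7_blocks => [|b s IH].
    by rewrite big_nil.
  by rewrite big_cons -IH addrC.
rewrite spin7_modelE rmorph_sum; apply: eq_big_seq => b bs /=.
rewrite w4; last by move: b bs; apply/allP.
have -> : [:: nth 0%N b.2 0; nth 0%N b.2 1; nth 0%N b.2 2; nth 0%N b.2 3] = b.2.
  by apply/eqP; move: b bs; apply/allP.
by rewrite rmorphN rmorphM mulNr.
Qed.

End Model.

(** * Algebra of the model and of adapted coframes *)

Section ModelIdentities.
Variable R : realType.
Implicit Types (A U V E G : 'M[R]_8) (i j k l a b p q : 'I_8).

Let F : 4.-tuple 'I_8 -> R := spin7_model 1%:M.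

Lemma model_swap12 i j k l : F [tuple j; i; k; l] = - F [tuple i; j; k; l].
Proof. by rewrite /F !spin7_model_phi phi_swap12 rmorphN. Qed.

Lemma model_swap23 i j k l : F [tuple i; k; j; l] = - F [tuple i; j; k; l].
Proof. by rewrite /F !spin7_model_phi phi_swap23 rmorphN. Qed.

Lemma model_swap34 i j k l : F [tuple i; j; l; k] = - F [tuple i; j; k; l].
Proof. by rewrite /F !spin7_model_phi phi_swap34 rmorphN. Qed.

Lemma kron2E i j a b : (kron2 i j a b)%:~R =
  (i == a)%:R * (j == b)%:R - (i == b)%:R * (j == a)%:R :> R.
Proof. by rewrite /kron2 rmorphB -!mulnb !PoszM !rmorphM. Qed.

Lemma model_contract i j a b :
  \sum_k \sum_l F [tuple i; j; k; l] * F [tuple a; b; k; l] =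
  6 * ((i == a)%:R * (j == b)%:R - (i == b)%:R * (j == a)%:R)
  - 4 * F [tuple i; j; a; b].
Proof.
have -> : 6 * ((i == a)%:R * (j == b)%:R - (i == b)%:R * (j == a)%:R)
    - 4 * F [tuple i; j; a; b] = (6 * kron2 i j a b - 4 * phi i j a b)%:~R.
  by rewrite rmorphB !rmorphM /= kron2E /F spin7_model_phi.
rewrite -phi_contract -sum8E; apply: eq_bigr => k _.
by rewrite -sum8E; apply: eq_bigr => l _; rewrite rmorphM /F !spin7_model_phi.
Qed.

(** One more trace of [model_contract]: the Kronecker part gives 6 (8 - 1) = 42, and the term in [F]
    has a repeated index and vanishes. *)
Lemma model_contract3 p a :
  \sum_j \sum_k \sum_l F [tuple p; j; k; l] * F [tuple a; j; k; l]
  = 42 * (p == a)%:R.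
Proof.
have h j : F [tuple p; j; a; j] = 0.
  have /eqP : F [tuple p; j; a; j] = - F [tuple p; j; a; j].
    rewrite {1}(model_swap23 p a j j) (model_swap34 p a j j) opprK.
    by rewrite (model_swap23 p j a j).
  by rewrite -subr_eq0 opprK -mulr2n mulrn_eq0 /= => /eqP.
under eq_bigr => j _ do rewrite model_contract h mulr0 subr0 eqxx mulr1.
rewrite -big_distrr sumrB /= sumr_const card_ord.
rewrite (bigD1 a)//= eqxx mulr1 big1 ?addr0 => [|j /negPf ja]; last first.
  by rewrite ja mulr0.
by case: eqVneq => _ /=; ring.
Qed.

Lemma act_tuple A H i j k l : act A H [tuple i; j; k; l] =
  \sum_p (A i p * H [tuple p; j; k; l] + A j p * H [tuple i; p; k; l]
    + A k p * H [tuple i; j; p; l] + A l p * H [tuple i; j; k; p]).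
Proof.
rewrite act4E /slot -!big_split; apply: eq_bigr => p _ /=.
have [-> -> -> ->] := subst4 i j k l p.
by rewrite !(tnth_nth i) !inordK.
Qed.

(* Contract act A F with F in its last three indices. *)
Lemma model_act_kernel A : A^T = - A -> act A F = (fun _ => 0) ->
  contract12 A F = 2 *: A.
Proof.
move=> Askew A0; apply/matrixP => i a; rewrite !mxE.
(* The first slot of [act A F] contributes 42 A ([T1]) and each of the other three contributes [S] =
   -6 A - 4 P(A), the trace of the skew [A] being zero. Hence 0 = 42 A + 3 S = 24 A - 12 P(A). *)
pose S := \sum_j \sum_p A j p * \sum_k \sum_l
  F [tuple i; p; k; l] * F [tuple a; j; k; l].
have trA : \sum_j A j j = 0.
  have /eqP : \tr A = - \tr A by rewrite -[LHS]mxtrace_tr Askew raddfN.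
  by rewrite -subr_eq0 opprK -mulr2n mulrn_eq0 /= => /eqP.
have SE : S = - 6 * A i a - 4 * \sum_p \sum_q A p q * F [tuple p; q; i; a].
  transitivity (6 * ((i == a)%:R * \sum_j A j j) - 6 * A i a
      - 4 * \sum_p \sum_q A p q * F [tuple p; q; i; a]); last first.
    by rewrite trA; ring.
  rewrite /S.
  under eq_bigr => j _ do under eq_bigr => p _ do rewrite model_contract.
  have -> : A i a = \sum_j (i == j)%:R * A j a.
    rewrite (bigD1 i)//= eqxx mul1r big1 ?addr0// => j /negPf ji.
    by rewrite eq_sym ji mul0r.
  rewrite !big_distrr -!sumrB; apply: eq_bigr => j _ /=.
  have -> : A j a = \sum_p (p == a)%:R * A j p.
    rewrite (bigD1 a)//= eqxx mul1r big1 ?addr0// => p /negPf pa.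
    by rewrite pa mul0r.
  have -> : A j j = \sum_p (p == j)%:R * A j p.
    rewrite (bigD1 j)//= eqxx mul1r big1 ?addr0// => p /negPf pa.
    by rewrite pa mul0r.
  rewrite !big_distrr -!sumrB; apply: eq_bigr => p _ /=.
  have -> : F [tuple i; p; a; j] = F [tuple j; p; i; a].
    rewrite (model_swap34 i p j a) (model_swap23 i j p a) (model_swap12 j i p a).
    by rewrite (model_swap23 j p i a) !opprK.
  by ring.
have swap3 b c d e : F [tuple b; c; d; e] = F [tuple b; d; e; c].
  by rewrite (model_swap23 b d c e) (model_swap34 b d e c) opprK.
have T1 : \sum_j \sum_k \sum_l \sum_p A i p * F [tuple p; j; k; l]
    * F [tuple a; j; k; l] = 42 * A i a.
  transitivity (\sum_p A i p * \sum_j \sum_k \sum_l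
      F [tuple p; j; k; l] * F [tuple a; j; k; l]).
    under eq_bigr do under eq_bigr do rewrite exchange_big /=.
    under eq_bigr do rewrite exchange_big /=.
    rewrite exchange_big; apply: eq_bigr => p _ /=.
    rewrite big_distrr; apply: eq_bigr => j _ /=.
    rewrite big_distrr; apply: eq_bigr => k _ /=.
    by rewrite big_distrr; apply: eq_bigr => l _ /=; rewrite mulrA.
  rewrite (bigD1 a)//= model_contract3 eqxx big1 => [|p /negPf pa].
    by rewrite addr0 mulr1 mulrC.
  by rewrite model_contract3 pa !mulr0.
have T2 : \sum_j \sum_k \sum_l \sum_p A j p * F [tuple i; p; k; l]
    * F [tuple a; j; k; l] = S.
  apply: eq_bigr => j _.
  under eq_bigr do rewrite exchange_big /=.
  rewrite exchange_big; apply: eq_bigr => p _ /=; rewrite big_distrr.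
  apply: eq_bigr => k _ /=; rewrite big_distrr; apply: eq_bigr => l _ /=.
  by rewrite mulrA.
have T3 : \sum_j \sum_k \sum_l \sum_p A k p * F [tuple i; j; p; l]
    * F [tuple a; j; k; l] = S.
  rewrite exchange_big -T2; apply: eq_bigr => k _; apply: eq_bigr => j _ /=.
  apply: eq_bigr => l _; apply: eq_bigr => p _.
  by rewrite (model_swap23 i p j l) (model_swap23 a k j l) !(mulrN, mulNr) opprK.
have T4 : \sum_j \sum_k \sum_l \sum_p A l p * F [tuple i; j; k; p]
    * F [tuple a; j; k; l] = S.
  under eq_bigr do rewrite exchange_big /=.
  rewrite exchange_big -T2; apply: eq_bigr => l _; apply: eq_bigr => j _ /=.
  apply: eq_bigr => k _; apply: eq_bigr => p _.
  by rewrite -(swap3 i p j k) -(swap3 a l j k).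
have : \sum_j \sum_k \sum_l act A F [tuple i; j; k; l] * F [tuple a; j; k; l] = 0.
  rewrite big1 // => j _; rewrite big1 // => k _; rewrite big1 // => l _.
  by rewrite A0 mul0r.
under eq_bigr => j _ do under eq_bigr => k _ do under eq_bigr => l _ do
  (rewrite act_tuple big_distrl /=; under eq_bigr => p _ do rewrite !mulrDl;
   rewrite !big_split /=).
under eq_bigr => j _ do under eq_bigr => k _ do rewrite !big_split /=.
under eq_bigr => j _ do rewrite !big_split /=.
rewrite !big_split /= T1 T2 T3 T4 SE => h.
by apply: (@mulfI _ 12); [rewrite pnatr_eq0|lra].
Qed.

Let genmx (e : 'I_8) : 'M[R]_8 := \matrix_(a, b) (gen e a b)%:~R.

Lemma model_gen_comm (e f : 'I_8) :
  let C := genmx e *m genmx f - genmx f *m genmx e in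
  contract12 C F = 2 *: C.
Proof.
have CE c d : (genmx e *m genmx f - genmx f *m genmx e) c d
    = (gen_comm e f c d)%:~R.
  rewrite /gen_comm !mxE rmorphB /= -!sum8E; congr (_ - _); apply: eq_bigr => p _;
    by rewrite !mxE rmorphM.
apply/matrixP => c d; rewrite [LHS]mxE [RHS]mxE CE.
transitivity ((2 * gen_comm e f c d)%:~R : R); last by rewrite rmorphM.
rewrite -phi_gen_comm -sum8E; apply: eq_bigr => a _.
by rewrite -sum8E; apply: eq_bigr => b _; rewrite CE /F spin7_model_phi rmorphM.
Qed.

(** On such a matrix 2 U - P(U) = 8 U, and [gen_complete] writes the left-hand side as a combination
    of generators. This is the origin of the coefficients, one eighth of the pairings of U with
    them. *)
Lemma model_eigen_gen U : U^T = - U -> contract12 U F = - 6 *: U ->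
  exists u : 'I_8 -> R, U = \sum_e u e *: genmx e.
Proof.
move=> Uskew UF.
exists (fun e => 8^-1 * \sum_c \sum_d U c d * (gen e c d)%:~R).
apply/matrixP => a b; rewrite summxE.
have U2 : \sum_c \sum_d U c d * ((c == a)%:R * (d == b)%:R
    - (c == b)%:R * (d == a)%:R) = 2 * U a b.
  have h (x y : 'I_8) : \sum_c \sum_d U c d * ((c == x)%:R * (d == y)%:R) = U x y.
    rewrite (bigD1 x)//= [X in _ + X]big1 ?addr0 => [|c /negPf cx]; last first.
      by rewrite big1// => d _; rewrite cx mul0r mulr0.
    rewrite (bigD1 y)//= [X in _ + X]big1 ?addr0 => [|c /negPf cx]; last first.
      by rewrite cx !mulr0.
    by rewrite !eqxx !mulr1.
  under eq_bigr do under eq_bigr do rewrite mulrBr.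
  under eq_bigr do rewrite sumrB.
  rewrite sumrB !h; have /matrixP/(_ a b) := Uskew; rewrite !mxE => ->; ring.
have U8 : 8 * U a b = \sum_c \sum_d U c d * (kron2 c d a b - phi c d a b)%:~R.
  under eq_bigr do under eq_bigr do rewrite rmorphB /= kron2E mulrBr.
  under eq_bigr do rewrite sumrB.
  rewrite sumrB U2; have /matrixP/(_ a b) := UF; rewrite !mxE.
  under eq_bigr do under eq_bigr do rewrite /F spin7_model_phi.
  by move=> ->; ring.
apply: (@mulfI _ 8); first by rewrite pnatr_eq0.
rewrite U8 big_distrr /=.
transitivity (\sum_c \sum_d \sum_(e < 8)
    U c d * ((gen e c d)%:~R * (gen e a b)%:~R)).
  apply: eq_bigr => c _; apply: eq_bigr => d _; rewrite -big_distrr /=.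
  congr (_ * _); rewrite gen_complete -sum8E; apply: eq_bigr => e _.
  by rewrite rmorphM.
under [LHS]eq_bigr => c _ do rewrite exchange_big /=.
rewrite [LHS]exchange_big; apply: eq_bigr => e _ /=.
rewrite !mxE !mulrA divff ?pnatr_eq0// mul1r big_distrl; apply: eq_bigr => c _.
by rewrite big_distrl; apply: eq_bigr => d _ /=; rewrite mulrA.
Qed.

Lemma model_eigen_comm U V : U^T = - U -> contract12 U F = - 6 *: U ->
  V^T = - V -> contract12 V F = - 6 *: V ->
  contract12 (U *m V - V *m U) F = 2 *: (U *m V - V *m U).
Proof.
move=> Us /(model_eigen_gen Us)[u ->] Vs /(model_eigen_gen Vs)[v ->].
have -> : (\sum_e u e *: genmx e) *m (\sum_f v f *: genmx f)
    - (\sum_f v f *: genmx f) *m (\sum_e u e *: genmx e)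
    = \sum_e \sum_f (u e * v f) *: (genmx e *m genmx f - genmx f *m genmx e).
  rewrite mulmx_suml mulmx_sumr -sumrB; apply: eq_bigr => e _.
  rewrite mulmx_sumr mulmx_suml -sumrB; apply: eq_bigr => f _.
  by rewrite scalerBr -!scalemxAl -!scalemxAr !scalerA [v f * _]mulrC.
rewrite contract12_sum scaler_sumr; apply: eq_bigr => e _.
rewrite contract12_sum scaler_sumr; apply: eq_bigr => f _.
by rewrite contract12Z model_gen_comm !scalerA mulrC.
Qed.

End ModelIdentities.

(** * Transfer of the model identities to an adapted coframe *)

Section Adapted.
Variable R : realType.
Variables (e G : 'M[R]_8) (Phi : 4.-tuple 'I_8 -> R).
Hypotheses (eG : e *m G *m e^T = 1%:M) (PhiE : Phi = spin7_model e).

Lemma coframe_unit : e \in unitmx.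
Proof. by have /mulmx1_unit[] : e *m (G *m e^T) = 1%:M by rewrite mulmxA. Qed.

Lemma frameE A : A = e^T *m (invmx e^T *m A *m invmx e) *m e.
Proof.
have ue := coframe_unit; have ueT : e^T \in unitmx by rewrite unitmx_tr.
by rewrite !mulmxA mulmxV// mul1mx -mulmxA mulVmx// mulmx1.
Qed.

Lemma frame_skew A : A^T = - A ->
  (invmx e^T *m A *m invmx e)^T = - (invmx e^T *m A *m invmx e).
Proof.
move=> As; rewrite !trmx_mul As !trmx_inv trmxK -mulmxA !mulNmx !mulmxN.
by rewrite mulmxA.
Qed.

(** Each [G] that raises an index meets e G e^T = 1, so in frame components P is the contraction
    with the model form. *)
Lemma contract12_frame A : contract12 (G *m (e^T *m A *m e) *m G) Phi
  = e^T *m contract12 A (spin7_model 1%:M) *m e.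
Proof.
rewrite PhiE spin7_model_pull contract12_pull !trmxK.
congr (_ *m contract12 _ _ *m _).
by rewrite !mulmxA eG mul1mx -!mulmxA [e *m (G *m _)]mulmxA eG mulmx1.
Qed.

Lemma frame_inj : injective (fun A : 'M[R]_8 => e^T *m A *m e).
Proof.
have ue := coframe_unit; have ueT : e^T \in unitmx by rewrite unitmx_tr.
by move=> A B /(can_inj (mulmxK ue))/(can_inj (mulKmx ueT)).
Qed.

Lemma spin7_act_kernel A : A^T = - A -> act (A *m G) Phi = (fun _ => 0) ->
  contract12 (G *m A *m G) Phi = 2 *: A.
Proof.
move=> As; rewrite (frameE A); set A' := invmx _ *m A *m _ => A0.
rewrite contract12_frame model_act_kernel ?frame_skew//.
  by rewrite -scalemxAr -scalemxAl.
have ueT : e^T \in unitmx by rewrite unitmx_tr coframe_unit.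
apply/funext => I; have := A0; rewrite PhiE spin7_model_pull.
(* The endomorphism A G becomes [A'] in the coframe, since A = e^T A' e and e G e^T = 1; the
   pullback is then undone to reach the model. *)
rewrite (@act_pull _ _ A'); last first.
  by rewrite /A' -!mulmxA [e *m (G *m _)]mulmxA eG mulmx1.
move=> /(congr1 (fun H => pull (invmx e^T) H I)).
by rewrite pullK ?mulVmx// pull0.
Qed.

Lemma spin7_eigen_comm U V : U^T = - U -> V^T = - V ->
  contract12 (G *m U *m G) Phi = - 6 *: U ->
  contract12 (G *m V *m G) Phi = - 6 *: V ->
  contract12 (G *m (U *m G *m V - V *m G *m U) *m G) Phi
  = 2 *: (U *m G *m V - V *m G *m U).
Proof.
move=> /frame_skew Us /frame_skew Vs.
rewrite [in X in X -> _](frameE U) [in X in _ -> X -> _](frameE V).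
rewrite [in X in _ -> _ -> X](frameE U) [in X in _ -> _ -> X](frameE V).
move: Us Vs; set U' := invmx _ *m U *m _; set V' := invmx _ *m V *m _ => Us Vs.
have sE c X : c *: (e^T *m X *m e) = e^T *m (c *: X) *m e.
  by rewrite -scalemxAr -scalemxAl.
rewrite !contract12_frame !sE.
move=> /frame_inj U6 /frame_inj V6.
have h X Y : e^T *m X *m e *m G *m (e^T *m Y *m e) = e^T *m (X *m Y) *m e.
  by rewrite -!mulmxA [e *m (G *m _)]mulmxA [_ *m (e^T *m _)]mulmxA eG mul1mx.
by rewrite !h -mulmxBl -mulmxBr contract12_frame model_eigen_comm// sE.
Qed.

End Adapted.

(** * Calculus of coordinate partial derivatives *)

Section PartialCalculus.
Variable R : realType.
Implicit Types (f g : 'rV[R]_8 -> R) (x y : 'rV[R]_8) (i j : 'I_8).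

(** Differentiability along the coordinate directions only: this is what [smooth_on] supplies, and
    it is stable under the algebra below. *)
Definition dable f x := forall i, derivable f x (delta_mx 0 i).

Lemma dable_cst (c : R) x : dable (fun _ => c) x.
Proof. by move=> i; exact: derivable_cst. Qed.

Lemma dableD f g x : dable f x -> dable g x -> dable (fun y => f y + g y) x.
Proof. by move=> df dg i; exact: derivableD (df i) (dg i). Qed.

Lemma dableM f g x : dable f x -> dable g x -> dable (fun y => f y * g y) x.
Proof. by move=> df dg i; exact: derivableM (df i) (dg i). Qed.

Lemma dable_sum (J : Type) (s : seq J) (F : J -> 'rV[R]_8 -> R) x :
  (forall n, dable (F n) x) -> dable (fun y => \sum_(n <- s) F n y) x.
Proof.
move=> dF; elim: s => [|n s IH].
  rewrite (_ : (fun y => _) = fun _ => 0); first exact: dable_cst.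
  by apply/funext => y; rewrite big_nil.
rewrite (_ : (fun y => _) = fun y => F n y + \sum_(n <- s) F n y).
  exact: dableD (dF n) IH.
by apply/funext => y; rewrite big_cons.
Qed.

Lemma dable_prod (J : Type) (s : seq J) (F : J -> 'rV[R]_8 -> R) x :
  (forall n, dable (F n) x) -> dable (fun y => \prod_(n <- s) F n y) x.
Proof.
move=> dF; elim: s => [|n s IH].
  rewrite (_ : (fun y => _) = fun _ => 1); first exact: dable_cst.
  by apply/funext => y; rewrite big_nil.
rewrite (_ : (fun y => _) = fun y => F n y * \prod_(n <- s) F n y).
  exact: dableM (dF n) IH.
by apply/funext => y; rewrite big_cons.
Qed.

Lemma dable_det n (A : 'rV[R]_8 -> 'M[R]_n) x :
  (forall a b, dable (fun y => A y a b) x) -> dable (fun y => \det (A y)) x.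
Proof.
move=> dA; rewrite /determinant; apply: dable_sum => s.
by apply: dableM; [exact: dable_cst | apply: dable_prod].
Qed.

Lemma dableV f x : f x != 0 -> dable f x -> dable (fun y => (f y)^-1) x.
Proof. by move=> f0 df i; exact: derivableV f0 (df i). Qed.

Lemma partial_cst (c : R) i x : partial i (fun _ => c) x = 0.
Proof. exact: derive_cst. Qed.

Lemma partialD f g i x : dable f x -> dable g x ->
  partial i (fun y => f y + g y) x = partial i f x + partial i g x.
Proof. by move=> df dg; exact: deriveD (df i) (dg i). Qed.

Lemma partialN f i x : dable f x -> partial i (fun y => - f y) x = - partial i f x.
Proof. by move=> df; exact: deriveN (df i). Qed.

Lemma partialM f g i x : dable f x -> dable g x ->
  partial i (fun y => f y * g y) x = partial i f x * g x + f x * partial i g x.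
Proof.
by move=> df dg; rewrite addrC [X in _ + X]mulrC; exact: deriveM (df i) (dg i).
Qed.

Lemma partial_sum (J : Type) (s : seq J) (F : J -> 'rV[R]_8 -> R) i x :
  (forall n, dable (F n) x) ->
  partial i (fun y => \sum_(n <- s) F n y) x = \sum_(n <- s) partial i (F n) x.
Proof.
move=> dF; elim: s => [|n s IH].
  rewrite big_nil (_ : (fun y => _) = fun _ => 0); first exact: partial_cst.
  by apply/funext => y; rewrite big_nil.
rewrite big_cons -IH -partialD//; last exact: dable_sum.
by congr (partial i _ x); apply/funext => y; rewrite big_cons.
Qed.

Section Open.
Variables (U : set 'rV[R]_8) (x : 'rV[R]_8).
Hypotheses (oU : open U) (Ux : U x).

Lemma partial_eq_on f g i : (forall y, U y -> f y = g y) ->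
  partial i f x = partial i g x.
Proof.
move=> fg; apply: near_eq_derive; near=> y; apply: fg; near: y.
exact: open_nbhs_nbhs.
Unshelve. all: by end_near. Qed.

Lemma dable_eq_on f g : (forall y, U y -> f y = g y) -> dable f x -> dable g x.
Proof.
move=> fg df i; apply: near_eq_derivable (df i); near=> y; apply: fg; near: y.
exact: open_nbhs_nbhs.
Unshelve. all: by end_near. Qed.

Lemma smooth_dable f : smooth_on U f -> dable f x.
Proof. by move=> /(_ [::] x Ux)[]. Qed.

Lemma smooth_partialC f i j : smooth_on U f ->
  partial i (partial j f) x = partial j (partial i f) x.
Proof.
move=> sf; apply: derive_comm.
- near=> y; have Uy : U y by near: y; exact: open_nbhs_nbhs.
  have [_ d0] := sf [::] y Uy.
  split; [exact: d0 j | exact: d0 i | exact: (sf [:: j] y Uy).2 i |].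
  exact: (sf [:: i] y Uy).2 j.
- exact: (sf [:: i; j] x Ux).1.
- exact: (sf [:: j; i] x Ux).1.
Unshelve. all: by end_near. Qed.

End Open.

Implicit Types (A B : 'rV[R]_8 -> 'M[R]_8).

Definition mdable A x := forall a b, dable (fun y => A y a b) x.

Definition Dmx i A x : 'M[R]_8 := \matrix_(a, b) partial i (fun y => A y a b) x.

Lemma mdableM A B x : mdable A x -> mdable B x ->
  mdable (fun y => A y *m B y) x.
Proof.
move=> dA dB a b.
rewrite (_ : (fun y => _) = fun y => \sum_c A y a c * B y c b).
  by apply: dable_sum => c; exact: dableM.
by apply/funext => y; rewrite mxE.
Qed.

Lemma mdableD A B x : mdable A x -> mdable B x -> mdable (fun y => A y + B y) x.
Proof.
move=> dA dB a b.
rewrite (_ : (fun y => _) = fun y => A y a b + B y a b); first exact: dableD.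
by apply/funext => y; rewrite mxE.
Qed.

Lemma mdable_tr A x : mdable A x -> mdable (fun y => (A y)^T) x.
Proof.
move=> dA a b; rewrite (_ : (fun y => _) = fun y => A y b a); first exact: dA.
by apply/funext => y; rewrite mxE.
Qed.

Lemma mdable_inv (U : set 'rV[R]_8) A x : open U -> U x ->
  (forall y, U y -> A y \in unitmx) -> mdable A x ->
  mdable (fun y => invmx (A y)) x.
Proof.
move=> oU Ux uA dA a b.
(* Cramer's rule, valid on all of [U], reduces the inverse to determinants and one reciprocal. *)
apply: (@dable_eq_on U x oU Ux (fun y => (\det (A y))^-1 * cofactor (A y) b a)).
  by move=> y Uy; rewrite /invmx uA// !mxE.
apply: dableM.
  apply: dableV; last exact: dable_det.
  by rewrite -unitfE -unitmxE uA.
rewrite /cofactor; apply: dableM; first exact: dable_cst.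
apply: dable_det => c d.
rewrite (_ : (fun y => _) = fun y => A y (lift b c) (lift a d)); first exact: dA.
by apply/funext => y; rewrite !mxE.
Qed.

Lemma DmxM i A B x : mdable A x -> mdable B x ->
  Dmx i (fun y => A y *m B y) x = Dmx i A x *m B x + A x *m Dmx i B x.
Proof.
move=> dA dB; apply/matrixP => a b; rewrite !mxE.
rewrite (_ : (fun y => _) = fun y => \sum_c A y a c * B y c b); last first.
  by apply/funext => y; rewrite mxE.
rewrite partial_sum => [|c]; last exact: dableM.
rewrite -big_split; apply: eq_bigr => c _ /=.
by rewrite partialM ?mxE; [|exact: dA|exact: dB].
Qed.

Lemma DmxD i A B x : mdable A x -> mdable B x ->
  Dmx i (fun y => A y + B y) x = Dmx i A x + Dmx i B x.
Proof.
move=> dA dB; apply/matrixP => a b; rewrite !mxE -partialD; [|exact: dA|exact: dB].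
by congr (partial i _ x); apply/funext => y; rewrite mxE.
Qed.

Lemma Dmx_tr i A x : Dmx i (fun y => (A y)^T) x = (Dmx i A x)^T.
Proof.
apply/matrixP => a b; rewrite !mxE.
by congr (partial i _ x); apply/funext => y; rewrite mxE.
Qed.

Lemma Dmx_eq_on (U : set 'rV[R]_8) i A B x : open U -> U x ->
  (forall y, U y -> A y = B y) -> Dmx i A x = Dmx i B x.
Proof.
move=> oU Ux AB; apply/matrixP => a b; rewrite !mxE.
by apply: (partial_eq_on oU Ux) => y Uy; rewrite AB.
Qed.

Lemma Dmx_cst i (M : 'M[R]_8) x : Dmx i (fun _ => M) x = 0.
Proof. by apply/matrixP => a b; rewrite !mxE partial_cst. Qed.

Lemma Dmx_comm (U : set 'rV[R]_8) i j A x : open U -> U x ->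
  (forall a b, smooth_on U (fun y => A y a b)) ->
  Dmx i (Dmx j A) x = Dmx j (Dmx i A) x.
Proof.
move=> oU Ux sA; apply/matrixP => a b.
have E m : (fun y => Dmx m A y a b) = partial m (fun y => A y a b).
  by apply/funext => y; rewrite mxE.
rewrite [LHS]mxE [RHS]mxE (E j) (E i).
exact: (smooth_partialC oU Ux i j (sA a b)).
Qed.

Lemma partial_act (k : nat) i A (F : 'rV[R]_8 -> k.-tuple 'I_8 -> R) I x :
  mdable A x -> (forall J, dable (fun y => F y J) x) ->
  partial i (fun y => act (A y) (F y) I) x = act (Dmx i A x) (F x) I
    + act (A x) (fun J => partial i (fun y => F y J) x) I.
Proof.
move=> dA dF; rewrite /act /slot.
rewrite partial_sum => [|r]; last by apply: dable_sum => p; exact: dableM.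
rewrite -big_split; apply: eq_bigr => r _ /=.
rewrite partial_sum => [|p]; last exact: dableM.
rewrite -big_split; apply: eq_bigr => p _ /=.
by rewrite partialM ?mxE; [|exact: dA|exact: dF].
Qed.

Lemma Dmx_contract12 i A (F : 'rV[R]_8 -> 4.-tuple 'I_8 -> R) x :
  mdable A x -> (forall J, dable (fun y => F y J) x) ->
  Dmx i (fun y => contract12 (A y) (F y)) x = contract12 (Dmx i A x) (F x)
    + contract12 (A x) (fun J => partial i (fun y => F y J) x).
Proof.
move=> dA dF; apply/matrixP => k l; rewrite !mxE.
rewrite (_ : (fun y => _) = fun y => \sum_p \sum_q A y p q * F y [tuple p; q; k; l]);
  last by apply/funext => y; rewrite mxE.
rewrite partial_sum => [|r]; last by apply: dable_sum => p; exact: dableM.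
rewrite -big_split; apply: eq_bigr => p _ /=.
rewrite partial_sum => [|q]; last exact: dableM.
rewrite -big_split; apply: eq_bigr => q _ /=.
by rewrite partialM ?mxE; [|exact: dA|exact: dF].
Qed.

End PartialCalculus.

Arguments smooth_dable {R U x} Ux {f} _ i.
Arguments mdableM {R A B x} _ _ a b i.
Arguments mdableD {R A B x} _ _ a b i.
Arguments mdable_tr {R A x} _ a b i.
Arguments mdable_inv {R U A x} _ _ _ _ a b i.
Arguments Dmx_eq_on {R U} i {A B x} _ _ _.
Arguments Dmx_comm {R U} i j {A x} _ _ _.

(** * The first Bianchi identity against an alternating tensor *)

Section AlternatingContraction.
Variables (R : realFieldType) (n : nat).
Variables (f : 'I_n -> 'I_n -> 'I_n -> 'I_n -> R) (W : 'I_n -> 'I_n -> 'I_n -> R).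
Hypothesis f_skew12 : forall i j k l, f j i k l = - f i j k l.
Hypothesis f_skew34 : forall i j k l, f i j l k = - f i j k l.
Hypothesis f_bianchi : forall i j k l, f i j k l + f j k i l + f k i j l = 0.
Hypothesis W_swap12 : forall a b c, W b a c = - W a b c.
Hypothesis W_swap13 : forall a b c, W c b a = - W a b c.

Lemma sum3_rot (F : 'I_n -> 'I_n -> 'I_n -> R) :
  \sum_a \sum_b \sum_c F b c a = \sum_a \sum_b \sum_c F a b c.
Proof.
rewrite exchange_big; apply: eq_bigr => b _ /=.
by rewrite exchange_big.
Qed.

(** The Bianchi identity on (i, j, c) and the exchange of i and c in [W] give S = - S + S3, where in
    S3 the first three indices of [f] are all contracted with [W]. As [W] is cyclic, averaging over
    rotations and using Bianchi again gives 3 S3 = 0. *)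
Lemma bianchi_alternating_sum j : \sum_i \sum_c \sum_d f i j c d * W c d i = 0.
Proof.
set S := LHS.
have W_cyc a b c : W b c a = W a b c.
  by rewrite (W_swap12 c b a) (W_swap13 a b c) opprK.
pose S3 := \sum_i \sum_c \sum_d f c i d j * W c d i.
have SE : S = - S + S3.
  have {2}-> : S = \sum_i \sum_c \sum_d f c j i d * W i d c.
    by rewrite /S exchange_big.
  rewrite /S3 /S -sumrN -big_split; apply: eq_bigr => i _ /=.
  rewrite -sumrN -big_split; apply: eq_bigr => c _ /=.
  rewrite -sumrN -big_split; apply: eq_bigr => d _ /=.
  have := f_bianchi i j c d; rewrite (f_skew12 c j) (f_skew34 c i d j).
  rewrite (W_swap13 c d i) mulrN opprK -mulrDl => h; congr (_ * _).
  by apply/eqP; rewrite -subr_eq0 opprD addrA h.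
have R1 : \sum_a \sum_b \sum_c f c b a j * W c a b = S3.
  exact: (sum3_rot (fun a b c => f b a c j * W b c a)).
have R2 : \sum_a \sum_b \sum_c f a c b j * W a b c = S3.
  by rewrite -R1; exact: (sum3_rot (fun a b c => f c b a j * W c a b)).
have S3E : S3 + S3 + S3 = 0.
  rewrite -{2}R1 -{1}R2 /S3 -!big_split big1 // => a _ /=.
  rewrite -!big_split big1 // => b _ /=; rewrite -!big_split big1 // => c _ /=.
  rewrite (W_cyc a b c) (W_cyc c a b) -!mulrDl.
  by rewrite f_bianchi mul0r.
lra.
Qed.

End AlternatingContraction.

Section Alternation.
Variable R : realType.
Implicit Types e : 'M[R]_8.

Lemma wedge4_tperm e a b c d (r s : 'I_4) (I : 4.-tuple 'I_8) : r != s ->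
  wedge4 e a b c d [tuple tnth I (tperm r s t) | t < 4] = - wedge4 e a b c d I.
Proof.
move=> rs; rewrite /wedge4.
set A := (X in _ = - \det X).
have -> : \matrix_(u, v) e (tnth [tuple inord a.-1; inord b.-1; inord c.-1; inord d.-1] u)
    (tnth [tuple tnth I (tperm r s t) | t < 4] v) = xcol r s A.
  by apply/matrixP => u v; rewrite !mxE tnth_mktuple.
by rewrite xcolE det_mulmx det_perm odd_tperm rs mulrN1.
Qed.

Lemma spin7_model_tperm e (r s : 'I_4) (I : 4.-tuple 'I_8) : r != s ->
  spin7_model e [tuple tnth I (tperm r s t) | t < 4] = - spin7_model e I.
Proof.
by move=> rs; rewrite /spin7_model !(wedge4_tperm e _ _ _ _ I rs); ring.
Qed.

Lemma spin7_model_swap12 e i j k l :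
  spin7_model e [tuple j; i; k; l] = - spin7_model e [tuple i; j; k; l].
Proof.
rewrite -(@spin7_model_tperm e (inord 0) (inord 1)); last first.
  by rewrite -val_eqE /= !inordK.
congr spin7_model; apply: eq_from_tnth => t; rewrite tnth_mktuple permE /=.
rewrite -!val_eqE /= !inordK//.
by case: t => -[|[|[|[|//]]]] //= t4; rewrite !(tnth_nth i) /= ?inordK.
Qed.

Lemma spin7_model_swap14 e i j k l :
  spin7_model e [tuple l; j; k; i] = - spin7_model e [tuple i; j; k; l].
Proof.
rewrite -(@spin7_model_tperm e (inord 0) (inord 3)); last first.
  by rewrite -val_eqE /= !inordK.
congr spin7_model; apply: eq_from_tnth => t; rewrite tnth_mktuple permE /=.
rewrite -!val_eqE /= !inordK//.
by case: t => -[|[|[|[|//]]]] //= t4; rewrite !(tnth_nth i) /= ?inordK.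
Qed.

End Alternation.

(** * The Ricci curvature in a chart *)

Section MatrixIdentities.
Variables (R : realFieldType) (n : nat).
Implicit Types A B g : 'M[R]_n.

Lemma mxD_entry A B a b : (A + B) a b = A a b + B a b.
Proof. by rewrite mxE. Qed.

Lemma mxN_entry A a b : (- A) a b = - A a b.
Proof. by rewrite mxE. Qed.

Lemma mxZ_entry c A a b : (c *: A) a b = c * A a b.
Proof. by rewrite mxE. Qed.

Lemma mx0_entry a b : (0 : 'M[R]_n) a b = 0.
Proof. by rewrite mxE. Qed.

Lemma trmxD A B : (A + B)^T = A^T + B^T.
Proof. exact: linearD. Qed.

Lemma trmxB A B : (A - B)^T = A^T - B^T.
Proof. exact: linearB. Qed.

Let mx_entry := (mxD_entry, mxN_entry, mxZ_entry, mx0_entry).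

(** The hypothesis equates the two second derivatives of a metric that is parallel for [Y]. Once
    products are expanded, noncommutative monomials are atoms at each entry, and linear arithmetic
    compares them; the identities below are proved likewise. *)
Lemma curvature_skew (Yi Yj Dij Dji g : 'M[R]_n) :
  Dij *m g + Yj *m (Yi *m g + g *m Yi^T)
    + ((Yi *m g + g *m Yi^T) *m Yj^T + g *m Dij^T)
  = Dji *m g + Yi *m (Yj *m g + g *m Yj^T)
    + ((Yj *m g + g *m Yj^T) *m Yi^T + g *m Dji^T) ->
  let F := Dij - Dji - (Yi *m Yj - Yj *m Yi) in
  F *m g + g *m F^T = 0.
Proof.
move=> + F; rewrite /F !trmxB !trmx_mul.
rewrite !(mulmxDl, mulmxDr, mulmxBl, mulmxBr, mulNmx, mulmxN) !mulmxA.
move=> /matrixP E; apply/matrixP => a b; move: (E a b).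
rewrite !mx_entry.  lra.
Qed.

Variables (C1 C2 T1 T2 D12 D21 G g : 'M[R]_n).
Hypotheses (G_sym : G^T = G) (T1_skew : T1^T = - T1).

(** The inverse metric stays parallel when the torsion is added to the connection: the two new terms
    G T1 G cancel because [T1] is skew. *)
Lemma metric_inv_torsion :
  - (G *m C1) - C1^T *m G
  = - (G *m (C1 + T1 *m G)) - (C1 + T1 *m G)^T *m G.
Proof.
rewrite trmxD trmx_mul G_sym T1_skew.
rewrite !(mulmxDl, mulmxDr, mulNmx, mulmxN) !mulmxA.
by apply/matrixP => a b; rewrite !mx_entry; lra.
Qed.

(** Skewness gives (T1 G)^T = - G T1, so the commutator is exactly what the torsion part of the
    connection contributes. This identifies Z_ij as the derivative of T_j by [Y]. *)
Lemma twisted_derivative :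
  D12 - C1 *m T2 - T2 *m C1^T - (T1 *m G *m T2 - T2 *m G *m T1)
  = D12 - (C1 + T1 *m G) *m T2 - T2 *m (C1 + T1 *m G)^T.
Proof.
rewrite trmxD trmx_mul G_sym T1_skew.
rewrite !(mulmxDl, mulmxDr, mulNmx, mulmxN) !mulmxA.
by apply/matrixP => a b; rewrite !mx_entry; lra.
Qed.

(** Raising both indices commutes with the derivative by [Y], because G is parallel for it. *)
Lemma twisted_derivative_raised (Y : 'M[R]_n) :
  let dG := - (G *m Y) - Y^T *m G in
  (dG *m T1 + G *m D12) *m G + G *m T1 *m dG
    + (Y^T *m (G *m T1 *m G) + G *m T1 *m G *m Y)
  = G *m (D12 - Y *m T1 - T1 *m Y^T) *m G.
Proof.
rewrite /= !(mulmxDl, mulmxDr, mulmxBl, mulmxBr, mulNmx, mulmxN) !mulmxA.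
by apply/matrixP => a b; rewrite !mx_entry; lra.
Qed.

Lemma twisted_curvature (dC12 dC21 : 'M[R]_n) : G *m g = 1%:M ->
  (dC12 + (D12 *m G + T2 *m (- (G *m C1) - C1^T *m G))
   - (dC21 + (D21 *m G + T1 *m (- (G *m C2) - C2^T *m G)))
   - ((C1 + T1 *m G) *m (C2 + T2 *m G) - (C2 + T2 *m G) *m (C1 + T1 *m G))) *m g
  = (dC12 - dC21 - (C1 *m C2 - C2 *m C1)) *m g
    + (D12 - C1 *m T2 - T2 *m C1^T) - (D21 - C2 *m T1 - T1 *m C2^T)
    - (T1 *m G *m T2 - T2 *m G *m T1).
Proof.
move=> Gg.
have GgX X : X *m G *m g = X by rewrite -mulmxA Gg mulmx1.
rewrite !(mulmxDl, mulmxDr, mulmxBl, mulmxBr, mulNmx, mulmxN) !mulmxA !GgX.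
by apply/matrixP => a b; rewrite !mx_entry; lra.
Qed.

End MatrixIdentities.

Definition mx_entry := (mxD_entry, mxN_entry, mxZ_entry, mx0_entry).

Lemma sum3_swap13 (R : realFieldType) (n : nat) (H : 'I_n -> 'I_n -> 'I_n -> R) :
  \sum_p \sum_q \sum_l H l q p = \sum_p \sum_q \sum_l H p q l.
Proof.
under eq_bigr => p _ do rewrite exchange_big /=.
rewrite exchange_big; apply: eq_bigr => l _ /=.
by rewrite exchange_big.
Qed.

(** Gathers the three copies of [G] into one tensor, [P] with three indices raised, whose
    alternation in c, d, i can then be set against the Bianchi identity. *)
Lemma raised_contraction_sum (R : realFieldType) (G M : 'M[R]_8)
    (P : 4.-tuple 'I_8 -> R) i k : G^T = G ->
  \sum_l G i l * contract12 (G *m M *m G) P k l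
  = \sum_c \sum_d M c d *
    \sum_p \sum_q \sum_l G c p * G d q * G i l * P [tuple p; q; k; l].
Proof.
move=> Gs.
have gs c p : G p c = G c p by rewrite -{1}Gs mxE.
pose h c d p q l := M c d * (G c p * G d q * G i l * P [tuple p; q; k; l]).
transitivity (\sum_l \sum_p \sum_q \sum_d \sum_c h c d p q l).
  apply: eq_bigr => l _; rewrite mxE big_distrr; apply: eq_bigr => p _ /=.
  rewrite big_distrr; apply: eq_bigr => q _ /=; rewrite mxE big_distrl big_distrr.
  apply: eq_bigr => d _ /=; rewrite mxE !big_distrl big_distrr.
  by apply: eq_bigr => c _ /=; rewrite /h (gs c p); ring.
transitivity (\sum_c \sum_d \sum_p \sum_q \sum_l h c d p q l); last first.
  apply: eq_bigr => c _; apply: eq_bigr => d _; rewrite big_distrr.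
  apply: eq_bigr => p _ /=; rewrite big_distrr; apply: eq_bigr => q _ /=.
  by rewrite big_distrr.
under [RHS]eq_bigr => c _ do under eq_bigr => d _ do under eq_bigr => p _ do
  rewrite exchange_big /=.
under [RHS]eq_bigr => c _ do under eq_bigr => d _ do rewrite exchange_big /=.
under [RHS]eq_bigr => c _ do rewrite exchange_big /=.
rewrite [RHS]exchange_big; apply: eq_bigr => l _ /=.
under [RHS]eq_bigr => c _ do rewrite exchange_big /=.
rewrite [RHS]exchange_big; apply: eq_bigr => p _ /=.
under [RHS]eq_bigr => c _ do rewrite exchange_big /=.
rewrite [RHS]exchange_big; apply: eq_bigr => q _ /=.
by rewrite exchange_big.
Qed.

(** * Curvature of the connection that preserves the form, in one chart *)

Section LocalGeometry.
Variables (R : realType) (U : set 'rV[R]_8).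
(* C m y k p is the Christoffel symbol Gamma^p_{mk}, T m y k l is T_{m;kl}. *)
Variables (C T : 'I_8 -> 'rV[R]_8 -> 'M[R]_8) (g : 'rV[R]_8 -> 'M[R]_8).
Variable Phi : 'rV[R]_8 -> 4.-tuple 'I_8 -> R.

Let G y : 'M[R]_8 := invmx (g y).
Let Y m y : 'M[R]_8 := C m y + T m y *m G y.

Hypothesis oU : open U.
Hypothesis smC : forall m a b, smooth_on U (fun y => C m y a b).
Hypothesis smT : forall m a b, smooth_on U (fun y => T m y a b).
Hypothesis smg : forall a b, smooth_on U (fun y => g y a b).
Hypothesis smPhi : forall I, smooth_on U (fun y => Phi y I).
Hypothesis g_unit : forall y, U y -> g y \in unitmx.
Hypothesis g_sym : forall y, U y -> (g y)^T = g y.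
Hypothesis C_sym : forall y, U y -> forall m k p, C m y k p = C k y m p.
Hypothesis dg : forall y, U y -> forall m,
  Dmx m g y = C m y *m g y + g y *m (C m y)^T.
Hypothesis T_skew : forall y, U y -> forall m, (T m y)^T = - T m y.
Hypothesis T_eigen : forall y, U y -> forall m,
  contract12 (G y *m T m y *m G y) (Phi y) = - 6 *: T m y.
Hypothesis dPhi : forall y, U y -> forall m I,
  partial m (fun z => Phi z I) y = act (Y m y) (Phi y) I.
Hypothesis adapted : forall y, U y -> exists e : 'M[R]_8,
  e *m G y *m e^T = 1%:M /\ Phi y = spin7_model e.

Variable x : 'rV[R]_8.
Hypothesis Ux : U x.

(** The covariant derivative with respect to the two form indices only; the Christoffel term on j is
    left out, being symmetric in i, j and so absent from antisymmetrised expressions. *)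
Definition covT i j : 'M[R]_8 := Dmx i (T j) x - C i x *m T j x - T j x *m (C i x)^T.

(** Rows of [C] carry the lower index, so nabla_i after nabla_j produces the product C_j C_i. The
    reversed order accounts for the sign of the commutator. *)
Definition curv i j : 'M[R]_8 :=
  Dmx i (C j) x - Dmx j (C i) x - (C i x *m C j x - C j x *m C i x).

Definition Tcomm i j : 'M[R]_8 := T i x *m G x *m T j x - T j x *m G x *m T i x.

Let mdC m : mdable (C m) x.
Proof. by move=> a b; exact (smooth_dable Ux (@smC m a b)). Qed.
Let mdT m : mdable (T m) x.
Proof. by move=> a b; exact (smooth_dable Ux (@smT m a b)). Qed.
Let mdg : mdable g x.
Proof. by move=> a b; exact (smooth_dable Ux (@smg a b)). Qed.
Let mdG : mdable G x.
Proof. exact (mdable_inv oU Ux g_unit (@mdg)). Qed.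
Let mdY m : mdable (Y m) x.
Proof. exact: mdableD (@mdC m) (mdableM (@mdT m) (@mdG)). Qed.

Lemma inv_sym y : U y -> (G y)^T = G y.
Proof. by move=> Uy; rewrite /G trmx_inv g_sym. Qed.

Let gG y : U y -> g y *m G y = 1%:M.
Proof. by move=> Uy; rewrite /G mulmxV// g_unit. Qed.
Let Gg y : U y -> G y *m g y = 1%:M.
Proof. by move=> Uy; rewrite /G mulVmx// g_unit. Qed.

Lemma Dmx_metric_inv m : Dmx m G x = - (G x *m C m x) - (C m x)^T *m G x.
Proof.
have h : Dmx m (fun y => g y *m G y) x = 0.
  by rewrite (Dmx_eq_on m oU Ux gG) Dmx_cst.
move: h; rewrite DmxM; [|exact: mdg|exact: mdG].
rewrite dg// => /(congr1 (mulmx (G x))).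
rewrite mulmx0 mulmxDr [X in _ + X]mulmxA Gg// mul1mx.
move=> /(canRL (addKr _)) ->; rewrite addr0 mulmxDl mulmxDr -!mulmxA gG// mulmx1.
by rewrite [G x *m (g x *m _)]mulmxA Gg// mul1mx opprD.
Qed.

Lemma dg_torsion y m : U y -> Dmx m g y = Y m y *m g y + g y *m (Y m y)^T.
Proof.
move=> Uy; rewrite dg// /Y mulmxDl trmxD mulmxDr -!mulmxA Gg// mulmx1.
rewrite trmx_mul inv_sym// T_skew// [g y *m (G y *m _)]mulmxA gG// mul1mx.
by rewrite addrACA subrr addr0.
Qed.

Definition Ycurv i j : 'M[R]_8 :=
  Dmx i (Y j) x - Dmx j (Y i) x - (Y i x *m Y j x - Y j x *m Y i x).

Lemma Ycurv_metric i j : Ycurv i j *m g x + g x *m (Ycurv i j)^T = 0.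
Proof.
have D2 m n : Dmx m (Dmx n g) x = Dmx m (Y n) x *m g x
    + Y n x *m (Y m x *m g x + g x *m (Y m x)^T)
    + ((Y m x *m g x + g x *m (Y m x)^T) *m (Y n x)^T
       + g x *m (Dmx m (Y n) x)^T).
  rewrite (Dmx_eq_on m oU Ux (fun y Uy => dg_torsion n Uy)).
  rewrite DmxD; [|exact (mdableM (@mdY n) (@mdg))|
    exact (mdableM (@mdg) (mdable_tr (@mdY n)))].
  rewrite DmxM; [|exact: mdY|exact: mdg].
  rewrite DmxM; [|exact: mdg|exact: mdable_tr (@mdY n)].
  by rewrite Dmx_tr dg_torsion.
have := Dmx_comm i j oU Ux smg; rewrite (D2 i j) (D2 j i).
exact: curvature_skew.
Qed.

Lemma Ycurv_Phi i j : act (Ycurv i j) (Phi x) = fun _ => 0.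
Proof.
have D2 m n I : partial m (partial n (fun y => Phi y I)) x
    = act (Dmx m (Y n) x) (Phi x) I + act (Y n x) (act (Y m x) (Phi x)) I.
  rewrite (partial_eq_on oU Ux m (fun y Uy => dPhi Uy n I)).
  rewrite partial_act; [|exact: mdY|]; last first.
    by move=> J; exact (smooth_dable Ux (@smPhi J)).
  by congr (_ + act _ _ I); apply/funext => J; rewrite dPhi.
apply/funext => I.
have := smooth_partialC oU Ux i j (@smPhi I); rewrite !D2 => E.
rewrite /Ycurv actDl actNl -act_comm actDl actNl; move: E.
move: (act (Dmx i _ x) _ _) (act (Dmx j _ x) _ _) => p q.
by move: (act (Y j x) _ _) (act (Y i x) _ _) => r t; lra.
Qed.

Let Z i j : 'M[R]_8 := covT i j - Tcomm i j.

(** The equation P(T_j) = -6 T_j is differentiated in coordinates; the terms in [Y] from G and from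
    [Phi] then assemble, on both sides, into the derivative of T_j by [Y]. *)
Lemma covT_eigen i j : contract12 (G x *m Z i j *m G x) (Phi x) = - 6 *: Z i j.
Proof.
have ZE : Z i j = Dmx i (T j) x - Y i x *m T j x - T j x *m (Y i x)^T.
  exact: twisted_derivative (inv_sym Ux) (T_skew Ux i).
have DG : Dmx i G x = - (G x *m Y i x) - (Y i x)^T *m G x.
  rewrite Dmx_metric_inv.
  exact: metric_inv_torsion (inv_sym Ux) (T_skew Ux i).
have := Dmx_eq_on i oU Ux (fun y Uy => T_eigen Uy j).
have mdGTG := mdableM (mdableM (@mdG) (@mdT j)) (@mdG).
rewrite Dmx_contract12; [|exact: mdGTG|]; last first.
  by move=> J; exact (smooth_dable Ux (@smPhi J)).
have -> : (fun J => partial i (fun y => Phi y J) x) = act (Y i x) (Phi x).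
  by apply/funext => J; rewrite dPhi.
rewrite contract12_act T_eigen//.
have -> : Dmx i (fun y => - 6 *: T j y) x = - 6 *: Dmx i (T j) x.
  have c6 : mdable (fun _ => (- 6)%:M : 'M[R]_8) x by move=> a b; exact: dable_cst.
  rewrite -mul_scalar_mx -[RHS]add0r -(mul0mx 8 (T j x)) -(Dmx_cst i (- 6)%:M x).
  rewrite -DmxM; [|exact: c6|exact: mdT].
  by congr (Dmx i _ x); apply/funext => y; rewrite mul_scalar_mx.
rewrite addrA addrA -contract12D.
have -> : Dmx i (fun y => G y *m T j y *m G y) x
    + ((Y i x)^T *m (G x *m T j x *m G x) + G x *m T j x *m G x *m Y i x)
    = G x *m Z i j *m G x.
  rewrite DmxM; [|exact (mdableM (@mdG) (@mdT j))|exact: mdG].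
  rewrite DmxM; [|exact: mdG|exact: mdT].
  by rewrite DG ZE twisted_derivative_raised.
rewrite ZE -scalemxAr -scalemxAl; move: (contract12 _ _) => P.
move: (Y i x *m T j x) (T j x *m (Y i x)^T) (Dmx i (T j) x) => M N DT.
by move=> /matrixP E; apply/matrixP => a b; move: (E a b); rewrite !mx_entry; lra.
Qed.

Let Rm i j : 'M[R]_8 := curv i j *m g x.

Lemma Ycurv_lowered i j :
  Ycurv i j *m g x = Rm i j + covT i j - covT j i - Tcomm i j.
Proof.
have DY m n : Dmx m (Y n) x = Dmx m (C n) x
    + (Dmx m (T n) x *m G x + T n x *m (- (G x *m C m x) - (C m x)^T *m G x)).
  rewrite DmxD; [|exact: mdC|exact (mdableM (@mdT n) (@mdG))].
  by rewrite DmxM; [rewrite Dmx_metric_inv|exact: mdT|exact: mdG].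
rewrite /Ycurv (DY i j) (DY j i).
exact: twisted_curvature (Gg Ux).
Qed.

Lemma Ycurv_lowered_skew i j : (Ycurv i j *m g x)^T = - (Ycurv i j *m g x).
Proof.
rewrite trmx_mul g_sym//; apply/eqP; rewrite -addr_eq0 addrC.
by rewrite Ycurv_metric.
Qed.

Lemma Tcomm_skew i j : (Tcomm i j)^T = - Tcomm i j.
Proof.
rewrite /Tcomm trmxB !trmx_mul inv_sym// !T_skew//.
by rewrite !(mulNmx, mulmxN) !opprK !mulmxA opprB.
Qed.

Lemma Tcomm_antisym i j : Tcomm j i = - Tcomm i j.
Proof. by rewrite /Tcomm opprB. Qed.

(** [Rm] is a sum of pieces with eigenvalue 2, the lowered [Ycurv] and [Tcomm], and of Z_ji - Z_ij
    with eigenvalue -6. Comparing with 2 [Rm] leaves the difference 8 on the latter. *)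
Lemma curv_eigen i j : contract12 (G x *m Rm i j *m G x) (Phi x)
  = 2 *: Rm i j + 8 *: (Z i j - Z j i).
Proof.
have [e [eG PhiE]] := adapted Ux.
have act0 : act (Ycurv i j *m g x *m G x) (Phi x) = fun _ => 0.
  by rewrite -mulmxA gG// mulmx1 Ycurv_Phi.
have A2 := spin7_act_kernel eG PhiE (Ycurv_lowered_skew i j) act0.
have B2 := spin7_eigen_comm eG PhiE (T_skew Ux i) (T_skew Ux j)
  (T_eigen Ux i) (T_eigen Ux j).
rewrite -/(Tcomm i j) in B2.
have RmE : Rm i j = Ycurv i j *m g x - Z i j + Z j i - Tcomm i j.
  rewrite Ycurv_lowered /Z (Tcomm_antisym i j).
  move: (Rm i j) (covT i j) (covT j i) (Tcomm i j) => r c1 c2 t.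
  by apply/matrixP => a b; rewrite !mx_entry; lra.
have Z1 := covT_eigen i j; have Z2 := covT_eigen j i.
have -> : G x *m Rm i j *m G x = G x *m (Ycurv i j *m g x) *m G x
    - G x *m Z i j *m G x + G x *m Z j i *m G x - G x *m Tcomm i j *m G x.
  rewrite RmE; move: (_ *m g x) (Z i j) (Z j i) (Tcomm i j) (G x) => r c1 c2 t H.
  by rewrite !(mulmxDl, mulmxDr, mulNmx, mulmxN).
rewrite !contract12D !contract12N A2 B2 Z1 Z2 RmE.
move: (Ycurv i j *m g x) (Z i j) (Z j i) (Tcomm i j) => r c1 c2 t.
by apply/matrixP => a b; rewrite !mx_entry; lra.
Qed.

Lemma covT_skew i j : (covT i j)^T = - covT i j.
Proof.
have DT : (Dmx i (T j) x)^T = - Dmx i (T j) x.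
  rewrite -Dmx_tr (Dmx_eq_on i oU Ux (fun y Uy => T_skew Uy j)).
  apply/matrixP => a b; rewrite !mxE -partialN; last exact: mdT.
  by congr (partial i _ x); apply/funext => y; rewrite mxE.
rewrite /covT !trmxB !trmx_mul trmxK DT T_skew// !(mulNmx, mulmxN).
move: (C i x *m T j x) (T j x *m (C i x)^T) (Dmx i (T j) x) => M N D.
by apply/matrixP => a b; rewrite !mx_entry; lra.
Qed.

Lemma Z_skew i j : (Z i j)^T = - Z i j.
Proof.
rewrite /Z trmxB covT_skew Tcomm_skew; move: (covT i j) (Tcomm i j) => M N.
by rewrite opprD.
Qed.

(** Every other term of [Ycurv_lowered] is already known to be skew. *)
Lemma Rm_skew i j : (Rm i j)^T = - Rm i j.
Proof.
have -> : Rm i j = Ycurv i j *m g x - covT i j + covT j i + Tcomm i j.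
  rewrite Ycurv_lowered; move: (Rm i j) (covT i j) (covT j i) (Tcomm i j).
  by move=> r c1 c2 t; apply/matrixP => a b; rewrite !mx_entry; lra.
rewrite trmxD trmxD trmxB Ycurv_lowered_skew !covT_skew Tcomm_skew.
move: (_ *m g x) (covT i j) (covT j i) (Tcomm i j) => r c1 c2 t.
by rewrite !opprD !opprK.
Qed.

Lemma Rm_antisym i j : Rm j i = - Rm i j.
Proof.
by rewrite /Rm -mulNmx /curv !opprB addrC -!addrA; congr (_ *m _).
Qed.

(** Symmetry of the Christoffel symbols makes derivative terms and quadratic terms cancel separately
    in the cyclic sum, already before lowering. *)
Lemma Rm_bianchi i j k l : Rm i j k l + Rm j k i l + Rm k i j l = 0.
Proof.
rewrite /Rm 3!mxE -!big_split big1 // => q _ /=; rewrite -!mulrDl.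
suff -> : curv i j k q + curv j k i q + curv k i j q = 0 by rewrite mul0r.
have CC m n p : (C m x *m C n x) p q = (C p x *m C n x) m q.
  by rewrite !mxE; apply: eq_bigr => r _; rewrite C_sym.
have DC m n p : Dmx m (C n) x p q = Dmx m (C p) x n q.
  by rewrite !mxE; apply: (partial_eq_on oU Ux) => y Uy; rewrite C_sym.
rewrite /curv !mx_entry (CC i j k) (CC j i k) (CC j k i) (DC i j k) (DC j i k).
by rewrite (DC k j i); lra.
Qed.

Lemma curv_contract_eq0 j k : \sum_i \sum_l
  G x i l * contract12 (G x *m Rm i j *m G x) (Phi x) k l = 0.
Proof.
have [e [_ PhiE]] := adapted Ux.
pose W c d i := \sum_p \sum_q \sum_l
  G x c p * G x d q * G x i l * Phi x [tuple p; q; k; l].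
under eq_bigr => i _ do rewrite (raised_contraction_sum _ _ _ _ (inv_sym Ux)).
apply: (@bianchi_alternating_sum R 8 (fun i j c d => Rm i j c d) W).
- by move=> a b c d; rewrite Rm_antisym mxN_entry.
- by move=> a b c d; have /matrixP/(_ c d) := Rm_skew a b; rewrite mxE mxN_entry.
- exact: Rm_bianchi.
- move=> a b c; rewrite /W exchange_big -sumrN; apply: eq_bigr => p _ /=.
  rewrite -sumrN; apply: eq_bigr => q _; rewrite -sumrN; apply: eq_bigr => l _.
  by rewrite PhiE spin7_model_swap12 mulrN [G x b q * _]mulrC.
- move=> a b c; rewrite /W -sum3_swap13 -sumrN; apply: eq_bigr => p _.
  rewrite -sumrN; apply: eq_bigr => q _; rewrite -sumrN; apply: eq_bigr => l _.
  rewrite PhiE spin7_model_swap14 mulrN; congr (- (_ * _)).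
  by rewrite mulrAC [RHS]mulrAC [G x a p * _]mulrC.
Qed.

Lemma ricci_local j k : \sum_i \sum_l Rm i j k l * G x i l
  = 4 * \sum_i \sum_l G x i l * (Z i j - Z j i) l k.
Proof.
have := curv_contract_eq0 j k.
have E i l : G x i l * contract12 (G x *m Rm i j *m G x) (Phi x) k l
    = 2 * (Rm i j k l * G x i l) - 8 * (G x i l * (Z i j - Z j i) l k).
  have DS : (Z i j - Z j i)^T = - (Z i j - Z j i).
    rewrite trmxB !Z_skew; move: (Z i j) (Z j i) => M N.
    by rewrite opprK opprB addrC.
  rewrite curv_eigen mxD_entry !mxZ_entry; move: (Z i j - Z j i) DS => D DS.
  (* Exchanging k and l turns the coefficient -4 that the contraction yields into the +4 of the
     statement. *)
  have -> : D k l = - D l k by rewrite -mxN_entry -DS mxE.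
  by move: (Rm i j k l) (G x i l) (D l k) => r u v; ring.
under eq_bigr => i _ do under eq_bigr => l _ do rewrite E.
under eq_bigr => i _ do rewrite sumrB -!big_distrr /=.
rewrite sumrB -!big_distrr /=.
move: (\sum_i \sum_l Rm i j k l * _) (\sum_i \sum_l G x i l * _) => u v h; lra.
Qed.

End LocalGeometry.

(** * Components on the manifold *)

Section Translation.
Variables (R : realType) (M : manifold8 R) (D : connection M) (a : atlas M).
Implicit Types (x y : 'rV[R]_8).

Lemma nablaE (k : nat) (t : local_tensor R k) x m (I : k.-tuple 'I_8) :
  nabla D a t x [tuple of m :: I] =
  partial m (fun y => t y I) x
  - act (\matrix_(k, p) D a x p m k) (t x) I.
Proof.
rewrite /nabla theadE.
have -> : [tuple of behead [tuple of m :: I]] = I by apply/val_inj.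
congr (_ - _); apply: eq_bigr => r _; apply: eq_bigr => p _.
by rewrite mxE.
Qed.

End Translation.

Lemma act_tuple2 (R : realType) (X : 'M[R]_8) (H : 2.-tuple 'I_8 -> R) i j :
  act X H [tuple i; j]
  = \sum_p X i p * H [tuple p; j] + \sum_p X j p * H [tuple i; p].
Proof.
rewrite /act; do 2 rewrite big_ord_recl; rewrite big_ord0 addr0 /slot.
congr (_ + _);
  apply: eq_bigr => p _; rewrite (tnth_nth i) /=; congr (_ * H _);
  by apply: eq_from_tnth => -[[|[|//]]] ?; rewrite tnth_subst.
Qed.

Lemma act_tuple3 (R : realType) (X : 'M[R]_8) (H : 3.-tuple 'I_8 -> R) i j k :
  act X H [tuple i; j; k]
  = \sum_p X i p * H [tuple p; j; k] + \sum_p X j p * H [tuple i; p; k]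
    + \sum_p X k p * H [tuple i; j; p].
Proof.
rewrite /act; do 3 rewrite big_ord_recl; rewrite big_ord0 addr0 addrA /slot.
congr (_ + _ + _);
  apply: eq_bigr => p _; rewrite (tnth_nth i) /=; congr (_ * H _);
  by apply: eq_from_tnth => -[[|[|[|//]]]] ?; rewrite tnth_subst.
Qed.

Lemma act_tuple1 (R : realType) (X : 'M[R]_8) (H : 1.-tuple 'I_8 -> R) i :
  act X H [tuple i] = \sum_p X i p * H [tuple p].
Proof.
rewrite /act big_ord_recl big_ord0 addr0 /slot.
apply: eq_bigr => p _; rewrite (tnth_nth i) /=; congr (_ * H _).
by apply: eq_from_tnth => -[[|//]] ?; rewrite tnth_subst.
Qed.

Section Main.
Variables (R : realType) (M : manifold8 R).
Variables (Phi : tensor_field M 4) (g : tensor_field M 2) (D : connection M).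
Variable T : tensor_field M 3.
Hypotheses (hPhi : spin7_structure Phi) (hg : spin7_metric Phi g).
Hypotheses (hD : levi_civita g D) (hT : torsion_tensor Phi g D T).
Variable a : atlas M.

Let U := img a.
Let C m y : 'M[R]_8 := \matrix_(k, p) D a y p m k.
Let t m y : 'M[R]_8 := \matrix_(b, c) T a y [tuple m; b; c].

Lemma img_open : open U.
Proof. exact: chart_img_open. Qed.

Let smC m b c : smooth_on U (fun y => C m y b c).
Proof.
have -> : (fun y => C m y b c) = fun y => D a y c m b.
  by apply/funext => y; rewrite mxE.
exact: gamma_smooth.
Qed.

Let smT m b c : smooth_on U (fun y => t m y b c).
Proof.
have -> : (fun y => t m y b c) = fun y => T a y [tuple m; b; c].
  by apply/funext => y; rewrite mxE.
exact: components_smooth.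
Qed.

Let smg b c : smooth_on U (fun y => gmx g a y b c).
Proof.
have -> : (fun y => gmx g a y b c) = fun y => g a y [tuple b; c].
  by apply/funext => y; rewrite mxE.
exact: components_smooth.
Qed.

Let smPhi I : smooth_on U (fun y => Phi a y I).
Proof. exact: components_smooth. Qed.

Lemma spin7_coframe y : U y -> exists e : 'M[R]_8,
  e *m invmx (gmx g a y) *m e^T = 1%:M /\ Phi a y = spin7_model e.
Proof.
move=> Uy; have [e [ue eP]] := hPhi Uy; exists e; split; last exact/funext.
by have [_ /(_ a y e Uy)] := hg; apply.
Qed.

Lemma gmx_unit y : U y -> gmx g a y \in unitmx.
Proof.
(* [invmx] returns a singular matrix unchanged, so it is invertible exactly when its argument is;
   the orthonormality relation exhibits its invertibility. *)
move=> /spin7_coframe[e [eG _]]; rewrite -unitmx_inv.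
have /mulmx1_unit[_] : e *m (invmx (gmx g a y) *m e^T) = 1%:M by rewrite mulmxA.
by rewrite unitmx_mul => /andP[].
Qed.

Lemma gmx_sym y : U y -> (gmx g a y)^T = gmx g a y.
Proof. by have [hgR _] := hg; move=> /hgR[]. Qed.

Lemma christoffel_sym y : U y -> forall m k p, C m y k p = C k y m p.
Proof. by move=> /hD[h _] m k p; rewrite !mxE h. Qed.

Lemma nabla_cons3 (x : 'rV[R]_8) (s : local_tensor R 2) m i j :
  nabla D a s x [tuple m; i; j] = partial m (fun y => s y [tuple i; j]) x
    - act (C m x) (s x) [tuple i; j].
Proof.
by rewrite -nablaE; congr nabla; apply/val_inj.
Qed.

Lemma nabla_cons4 (x : 'rV[R]_8) (s : local_tensor R 3) m i j k :
  nabla D a s x [tuple m; i; j; k] = partial m (fun y => s y [tuple i; j; k]) x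
    - act (C m x) (s x) [tuple i; j; k].
Proof.
by rewrite -nablaE; congr nabla; apply/val_inj.
Qed.

Lemma nabla_cons5 (x : 'rV[R]_8) (s : local_tensor R 4) m i j k l :
  nabla D a s x [tuple m; i; j; k; l] =
    partial m (fun y => s y [tuple i; j; k; l]) x
    - act (C m x) (s x) [tuple i; j; k; l].
Proof.
by rewrite -nablaE; congr nabla; apply/val_inj.
Qed.

Lemma Dmx_gmx y : U y -> forall m,
  Dmx m (gmx g a) y = C m y *m gmx g a y + gmx g a y *m (C m y)^T.
Proof.
move=> Uy m; apply/matrixP => i j; have [_ /(_ m i j)] := hD Uy.
rewrite nabla_cons3 act_tuple2 => /subr0_eq E; rewrite [LHS]mxE.
transitivity (partial m (fun z => g a z [tuple i; j]) y).
  by congr (partial m _ y); apply/funext => z; rewrite mxE.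
rewrite E !mxE; congr (_ + _); apply: eq_bigr => p _; rewrite !mxE//.
by rewrite mulrC.
Qed.

Lemma T_skewmx y : U y -> forall m, (t m y)^T = - t m y.
Proof.
move=> Uy m; have [[h _] _] := hT Uy m.
by apply/matrixP => i j; rewrite !mxE h.
Qed.

Lemma T_eigenmx y : U y -> forall m,
  contract12 (invmx (gmx g a y) *m t m y *m invmx (gmx g a y)) (Phi a y)
  = - 6 *: t m y.
Proof.
move=> Uy m; have [[_ h] _] := hT Uy m.
have gs p c : ginv g a y p c = ginv g a y c p.
  have : (ginv g a y)^T = ginv g a y by rewrite /ginv trmx_inv gmx_sym.
  by move=> /matrixP/(_ c p); rewrite mxE.
apply/matrixP => i j; rewrite [RHS]mxE [t m y i j]mxE -h [LHS]mxE.
rewrite -/(ginv g a y); move: (ginv g a y) gs => G gs.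
transitivity (\sum_p \sum_q \sum_c \sum_d T a y [tuple m; c; d] * G c p * G d q
    * Phi a y [tuple p; q; i; j]).
  apply: eq_bigr => p _; apply: eq_bigr => q _; rewrite exchange_big mxE big_distrl.
  apply: eq_bigr => d _ /=; rewrite mxE !big_distrl; apply: eq_bigr => c _ /=.
  by rewrite mxE (gs p c) [G c p * _]mulrC.
under eq_bigr => p _ do rewrite exchange_big /=.
rewrite exchange_big; apply: eq_bigr => c _ /=.
under eq_bigr => p _ do rewrite exchange_big /=.
by rewrite exchange_big.
Qed.

Lemma partial_Phi y : U y -> forall m I, partial m (fun z => Phi a z I) y
  = act (C m y + t m y *m invmx (gmx g a y)) (Phi a y) I.
Proof.
move=> Uy m I; have [_ h] := hT Uy m.
have -> : I = [tuple tnth I (inord 0); tnth I (inord 1); tnth I (inord 2);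
    tnth I (inord 3)].
  apply: eq_from_tnth => -[[|[|[|[|//]]]] ?]; rewrite [RHS](tnth_nth ord0) /=;
  by congr tnth; apply/val_inj; rewrite /= inordK.
move: (tnth I _) (tnth I _) (tnth I _) (tnth I _) => l k j i.
have := h i j k l; rewrite nabla_cons5 => /(canRL (subrK _)) ->.
rewrite actDl [RHS]addrC; congr (_ + _); rewrite act_tuple.
rewrite exchange_big; apply: eq_bigr => q _ /=; rewrite !big_split /=.
by rewrite !mxE !big_distrl; congr (_ + _ + _ + _); apply: eq_bigr => p _; rewrite mxE.
Qed.

Variable x : 'rV[R]_8.
Hypothesis Ux : U x.

Let G y : 'M[R]_8 := invmx (gmx g a y).

Let md (A : 'rV[R]_8 -> 'M[R]_8) :
  (forall b c, smooth_on U (fun y => A y b c)) -> mdable A x.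
Proof. by move=> sA b c; exact (smooth_dable Ux (sA b c)). Qed.

Let mdG : mdable G x.
Proof. exact (mdable_inv img_open Ux gmx_unit (md smg)). Qed.

Lemma riemE i j k l : riem g D a x i j k l = (curv C x i j *m gmx g a x) k l.
Proof.
have E m n q : nabla_vec D a m (nabla_vec D a n (@coord_vec R k)) x q
    = Dmx m (C n) x k q + (C n x *m C m x) k q.
  have E1 y p : nabla_vec D a n (@coord_vec R k) y p = C n y k p.
    rewrite /nabla_vec /coord_vec partial_cst add0r (bigD1 k)//= big1.
      by rewrite eqxx mulr1 addr0 mxE.
    by move=> r /negPf rk; rewrite rk mulr0.
  rewrite {1}/nabla_vec !mxE; congr (_ + _).
    by congr (partial m _ x); apply/funext => y; rewrite E1.
  by apply: eq_bigr => p _; rewrite E1 [C m x p q]mxE mulrC.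
rewrite /riem mxE; apply: eq_bigr => q _; congr (_ * _).
by rewrite !E /curv !mx_entry; lra.
Qed.

Lemma nabla_torsion i j l k : nabla D a (T a) x [tuple i; j; l; k]
  = covT C t x i j l k - \sum_p C i x j p * t p x l k.
Proof.
rewrite nabla_cons4 act_tuple3 /covT !mx_entry !mxE.
have -> : partial i (fun y => t j y l k) x
    = partial i (fun y => T a y [tuple j; l; k]) x.
  by congr (partial i _ x); apply/funext => y; rewrite mxE.
have -> : \sum_p C i x l p * T a x [tuple j; p; k]
    = \sum_p C i x l p * t j x p k by apply: eq_bigr => p _; rewrite [t _ _ _ _]mxE.
have -> : \sum_p C i x k p * T a x [tuple j; l; p]
    = \sum_p t j x l p * (C i x)^T p k.
  by apply: eq_bigr => p _; rewrite [t _ _ _ _]mxE [_^T p k]mxE mulrC.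
have -> : \sum_p C i x j p * T a x [tuple p; l; k]
    = \sum_p C i x j p * t p x l k by apply: eq_bigr => p _; rewrite [t _ _ _ _]mxE.
lra.
Qed.

(** The contraction commutes with nabla because the inverse metric is parallel: one half of its
    derivative supplies the Christoffel term on l, the other half the one on i. *)
Lemma nabla_trace j k : nabla D a (torsion_trace g T a) x [tuple j; k]
  = \sum_i \sum_l G x i l *
      (covT C t x j i l k - \sum_p C j x i p * t p x l k).
Proof.
have trE y p : torsion_trace g T a y [tuple p] = \sum_i \sum_l G y i l * t i y l p.
  by apply: eq_bigr => i _; apply: eq_bigr => l _; rewrite mxE theadE.
have dt i l : dable (fun y => t i y l k) x by exact (smooth_dable Ux (smT i l k)).
have -> : nabla D a (torsion_trace g T a) x [tuple j; k]
    = partial j (fun y => torsion_trace g T a y [tuple k]) x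
      - act (C j x) (torsion_trace g T a x) [tuple k].
  by rewrite -nablaE; congr nabla; apply/val_inj.
rewrite act_tuple1.
have -> : (fun y => torsion_trace g T a y [tuple k])
    = fun y => \sum_i \sum_l G y i l * t i y l k.
  by apply/funext => y; rewrite trE.
rewrite partial_sum => [|i]; last first.
  by apply: dable_sum => l; apply: dableM; [exact: mdG|exact: dt].
have -> : \sum_i partial j (fun y => \sum_l G y i l * t i y l k) x
    = \sum_i \sum_l (Dmx j G x i l * t i x l k + G x i l * Dmx j (t i) x l k).
  apply: eq_bigr => i _; rewrite partial_sum => [|l]; last first.
    by apply: dableM; [exact: mdG|exact: dt].
  apply: eq_bigr => l _; rewrite partialM; [|exact: mdG|exact: dt].
  by rewrite [Dmx j G x i l]mxE [Dmx j (t i) x l k]mxE.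
have -> : Dmx j G x = - (G x *m C j x) - (C j x)^T *m G x.
  exact: (Dmx_metric_inv img_open smg gmx_unit Dmx_gmx Ux).
have -> : \sum_p C j x k p * torsion_trace g T a x [tuple p]
    = \sum_i \sum_l G x i l * (t i x *m (C j x)^T) l k.
  under eq_bigr => p _ do rewrite trE big_distrr /=.
  rewrite exchange_big; apply: eq_bigr => i _ /=.
  under eq_bigr => p _ do rewrite big_distrr /=.
  rewrite exchange_big; apply: eq_bigr => l _ /=.
  rewrite mxE big_distrr; apply: eq_bigr => p _ /=.
  by rewrite [_^T p k]mxE mulrCA [C j x k p * _]mulrC.
have E1 : \sum_i \sum_l (G x *m C j x) i l * t i x l k
    = \sum_i \sum_l G x i l * (C j x *m t i x) l k.
  apply: eq_bigr => i _; under eq_bigr => l _ do rewrite mxE big_distrl /=.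
  rewrite exchange_big; apply: eq_bigr => p _ /=.
  by rewrite mxE big_distrr; apply: eq_bigr => l _ /=; rewrite mulrA.
have E2 : \sum_i \sum_l ((C j x)^T *m G x) i l * t i x l k
    = \sum_i \sum_l G x i l * \sum_p C j x i p * t p x l k.
  under eq_bigr => i _ do under eq_bigr => l _ do rewrite mxE big_distrl /=.
  under eq_bigr => i _ do rewrite exchange_big /=.
  rewrite exchange_big; apply: eq_bigr => p _ /=.
  rewrite exchange_big; apply: eq_bigr => l _ /=.
  rewrite big_distrr; apply: eq_bigr => i _ /=.
  by rewrite [_^T i p]mxE mulrAC mulrA mulrC mulrA.
have -> : \sum_i \sum_l ((- (G x *m C j x) - (C j x)^T *m G x) i l * t i x l k
      + G x i l * Dmx j (t i) x l k)
    = \sum_i \sum_l G x i l * Dmx j (t i) x l k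
      - \sum_i \sum_l (G x *m C j x) i l * t i x l k
      - \sum_i \sum_l ((C j x)^T *m G x) i l * t i x l k.
  rewrite -!sumrB; apply: eq_bigr => i _; rewrite -!sumrB; apply: eq_bigr => l _.
  by rewrite !mx_entry; ring.
rewrite E1 E2 -!sumrB; apply: eq_bigr => i _; rewrite -!sumrB.
by apply: eq_bigr => l _; rewrite /covT !mx_entry; ring.
Qed.

Lemma ricci_torsion j k : ricci g D a x j k =
    4 * (\sum_(i < 8) \sum_(l < 8)
           ginv g a x i l * nabla D a (T a) x [tuple i; j; l; k])
    - 4 * nabla D a (torsion_trace g T a) x [tuple j; k]
    + 8 * (\sum_(m < 8) \sum_(n < 8) \sum_(i < 8) \sum_(l < 8)
             T a x [tuple j; m; k] * T a x [tuple i; n; l]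
             * ginv g a x m n * ginv g a x i l)
    - 8 * (\sum_(m < 8) \sum_(n < 8) \sum_(i < 8) \sum_(l < 8)
             T a x [tuple j; m; l] * T a x [tuple i; n; k]
             * ginv g a x m n * ginv g a x i l).
Proof.
have -> : ricci g D a x j k
    = \sum_i \sum_l (curv C x i j *m gmx g a x) k l * G x i l.
  by apply: eq_bigr => i _; apply: eq_bigr => l _; rewrite riemE.
have Lric := ricci_local img_open smC smT smg smPhi gmx_unit gmx_sym
  christoffel_sym Dmx_gmx T_skewmx T_eigenmx partial_Phi spin7_coframe Ux j k.
rewrite [LHS]Lric /=.
have Gs : (G x)^T = G x by rewrite /G trmx_inv gmx_sym.
have gs p q : G x p q = G x q p by rewrite -{1}Gs mxE.
have ts m p q : T a x [tuple m; p; q] = - T a x [tuple m; q; p].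
  by have [[h _] _] := hT Ux m; exact: h.
have sum4C (H : 'I_8 -> 'I_8 -> 'I_8 -> 'I_8 -> R) :
    \sum_m \sum_n \sum_i \sum_l H m n i l = \sum_i \sum_l \sum_m \sum_n H m n i l.
  under eq_bigr => m _ do rewrite exchange_big /=.
  rewrite exchange_big; apply: eq_bigr => i _ /=.
  under eq_bigr => m _ do rewrite exchange_big /=.
  by rewrite exchange_big.
have E8a : \sum_m \sum_n \sum_i \sum_l
      T a x [tuple j; m; k] * T a x [tuple i; n; l] * G x m n * G x i l
    = - \sum_i \sum_l G x i l * (t i x *m G x *m t j x) l k.
  rewrite sum4C -sumrN; apply: eq_bigr => i _; rewrite -sumrN; apply: eq_bigr => l _.
  rewrite mxE big_distrr -sumrN; apply: eq_bigr => m _ /=.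
  rewrite mxE big_distrl big_distrr -sumrN; apply: eq_bigr => n _ /=.
  rewrite (ts i n l) [t i x l n]mxE [t j x m k]mxE (gs n m); ring.
have E8b : \sum_m \sum_n \sum_i \sum_l
      T a x [tuple j; m; l] * T a x [tuple i; n; k] * G x m n * G x i l
    = - \sum_i \sum_l G x i l * (t j x *m G x *m t i x) l k.
  rewrite sum4C -sumrN; apply: eq_bigr => i _; rewrite -sumrN; apply: eq_bigr => l _.
  rewrite mxE big_distrr -sumrN exchange_big; apply: eq_bigr => n _ /=.
  rewrite mxE big_distrl big_distrr -sumrN; apply: eq_bigr => m _ /=.
  rewrite (ts j m l) [t j x l m]mxE [t i x n k]mxE; ring.
rewrite -/(G x) E8a E8b nabla_trace.
under [X in 4 * X - _]eq_bigr => i _ do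
  under eq_bigr => l _ do rewrite nabla_torsion.
rewrite -/(G x); set S1 := (X in 4 * X - _); set S2 := (X in _ - 4 * X + _ - _).
set S3 := (X in _ + 8 * - X - _); set S4 := (X in _ - 8 * - X).
(* The commutator is antisymmetric, so Z_ij - Z_ji contains it twice; this turns the factor 4 into 8
   on the quadratic terms. *)
have -> : \sum_i \sum_l G x i l * (covT C t x i j - Tcomm t (gmx g a) x i j
    - (covT C t x j i - Tcomm t (gmx g a) x j i)) l k
    = S1 - S2 - (S3 + S3) + (S4 + S4); last by ring.
rewrite /S1 /S2 /S3 /S4 -!big_split /= -!sumrB -big_split /=.
apply: eq_bigr => i _; rewrite -!big_split /= -!sumrB -big_split /=.
apply: eq_bigr => l _; rewrite /Tcomm !mx_entry.
(* These Christoffel terms are what separates nabla from [covT] in the two derivative terms; they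
   cancel since the connection is torsion-free. *)
have -> : \sum_p C i x j p * t p x l k = \sum_p C j x i p * t p x l k.
  by apply: eq_bigr => p _; rewrite christoffel_sym.
by rewrite -/(G x); ring.
Qed.

End Main.

Theorem proposition4p6 (R : realType) (M : manifold8 R)
  (Phi : tensor_field M 4) (g : tensor_field M 2) (D : connection M)
  (T : tensor_field M 3)
  (hPhi : spin7_structure Phi) (hg : spin7_metric Phi g)
  (hD : levi_civita g D) (hT : torsion_tensor Phi g D T)
  (a : atlas M) (x : 'rV[R]_8) (hx : img a x) (j k : 'I_8) :
  ricci g D a x j k =
    4 * (\sum_(i < 8) \sum_(l < 8)
           ginv g a x i l * nabla D a (T a) x [tuple i; j; l; k])
    - 4 * nabla D a (torsion_trace g T a) x [tuple j; k]
    + 8 * (\sum_(m < 8) \sum_(n < 8) \sum_(i < 8) \sum_(l < 8)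
             T a x [tuple j; m; k] * T a x [tuple i; n; l]
             * ginv g a x m n * ginv g a x i l)
    - 8 * (\sum_(m < 8) \sum_(n < 8) \sum_(i < 8) \sum_(l < 8)
             T a x [tuple j; m; l] * T a x [tuple i; n; k]
             * ginv g a x m n * ginv g a x i l).
Proof. exact (ricci_torsion hPhi hg hD hT hx j k). Qed.
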